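(* Let $(\mathcal F_0,\mathbf a)$ be initial data for the completion problem in $\mathbb C^d$ with $\mathbf a=\mathbf a^\downarrow\in\mathbb R_{>0}^k$ and $d-k>0$, let $\lambda=\lambda^\uparrow(S_{\mathcal F_0})$, and let $f:[0,\infty)\to[0,\infty)$ be strictly convex. Put $\lambda'=(\lambda_1,\dots,\lambda_k)\in\mathbb R_{\ge0}^k$. Then $$\nu_f(\lambda,\mathbf a)=\big(\nu_f(\lambda',\mathbf a),\lambda_{k+1},\dots,\lambda_d\big),$$ where $\nu_f(\lambda',\mathbf a)$ is the vector $\mathcal N(\lambda',\mathbf a)$ produced by the recursive construction in the context (applied with dimension $d'=k$). In this case the vector $\nu=\nu_f(\lambda,\mathbf a)$ is the same for every strictly convex $f:[0,\infty)\to[0,\infty)$ and, with $\Lambda(\mathcal C_{\mathbf a}(\mathcal F_0))=\{\lambda(S_{\mathcal F}):\mathcal F\in\mathcal C_{\mathbf a}(\mathcal F_0)\}$, it satisfies $$\nu^\downarrow\in\Lambda(\mathcal C_{\mathbf a}(\mathcal F_0))\quad\text{and}\quad\nu^\downarrow\prec\gamma\ \text{ for every }\gamma\in\Lambda(\mathcal C_{\mathbf a}(\mathcal F_0)).$$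
   Context: Notation. $\mathbf 1_m\in\mathbb R^m$ is the all-ones vector; $\operatorname{tr}x=\sum_i x_i$; $x^\downarrow$ (resp. $x^\uparrow$) is the rearrangement of $x$ in decreasing (resp. increasing) order. For $x,y\in\mathbb R^m$, $x\prec y$ means $\sum_{i\le j}x_i^\downarrow\le\sum_{i\le j}y_i^\downarrow$ for all $j$ and $\operatorname{tr}x=\operatorname{tr}y$; for vectors of different sizes (non-negative entries) complete with zeros. For a finite sequence $\mathcal F=\{f_i\}$ in $\mathcal H=\mathbb C^d$, $S_{\mathcal F}=\sum_i f_i\otimes f_i$ is its frame operator, where $(x\otimes y)(z)=\langle z,y\rangle x$. For positive semidefinite $S$, $\lambda(S)=\lambda^\downarrow(S)$ (resp. $\lambda^\uparrow(S)$) is the vector of its eigenvalues with multiplicity in decreasing (resp. increasing) order. Initial data for the completion problem: a finite sequence $\mathcal F_0=\{f_i\}_{i=1}^{n_0}$ in $\mathcal H$ and $\mathbf a=(a_i)_{i=1}^k\in\mathbb R_{>0}^k$ with $a_1\ge\dots\ge a_k$ and $d-\operatorname{rk}S_{\mathcal F_0}\le k$. $\mathcal C_{\mathbf a}(\mathcal F_0)=\{(\mathcal F_0,\mathcal G):\mathcal G=\{g_i\}_{i=1}^k\subset\mathcal H,\ \|g_i\|^2=a_i\ (1\le i\le k)\}$. For $e\in\mathbb N$ let $\Gamma_e(\mathbf a)=\{\gamma\in\mathbb R_{\ge0}^e:\gamma=\gamma^\downarrow,\ \mathbf a\prec\gamma\}$. For $\rho=\rho^\uparrow\in\mathbb R_{\ge0}^e$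 and strictly convex $f:[0,\infty)\to[0,\infty)$ there is a unique $\mu_f(\rho,\mathbf a)\in\Gamma_e(\mathbf a)$ minimizing $\gamma\mapsto\sum_{i=1}^e f(\rho_i+\gamma_i)$ on $\Gamma_e(\mathbf a)$; set $\nu_f(\rho,\mathbf a)=\rho+\mu_f(\rho,\mathbf a)$. A completion $\mathcal F=(\mathcal F_0,\mathcal G)$ is a global minimizer of $P_f(\mathcal F)=\sum_{i=1}^d f(\lambda_i(S_{\mathcal F}))$ on $\mathcal C_{\mathbf a}(\mathcal F_0)$ iff $\lambda(S_{\mathcal G})=\mu_f(\lambda,\mathbf a)$ and $\lambda(S_{\mathcal F})=\nu_f(\lambda,\mathbf a)^\downarrow$. Feasibility. For $\rho=\rho^\uparrow\in\mathbb R_{\ge0}^e$, $\mathbf b=\mathbf b^\downarrow\in\mathbb R_{>0}^l$ with $l\ge e$, and $t=\operatorname{tr}\rho+\operatorname{tr}\mathbf b$, define $\nu(\rho,\mathbf b)=\frac te\mathbf 1_e$ if $\rho_e\le\frac te$; otherwise $\nu(\rho,\mathbf b)=(c\mathbf 1_s,\rho_{s+1},\dots,\rho_e)$ where $s\in\{1,\dots,e-1\}$ is the unique index such that $c=\frac1s[\operatorname{tr}\mathbf b+\sum_{i=1}^s\rho_i]$ satisfies $\rho_s\le c<\rho_{s+1}$. The pair $(\rho,\mathbf b)$ is feasible if $\mathbf b\prec\nu(\rho,\mathbf b)-\rho$. Construction of $\mathcal N(\rho,\mathbf a)$ for $\rho=\rho^\uparrow\in\mathbb R_{\ge0}^e$,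 $\mathbf a=\mathbf a^\downarrow\in\mathbb R_{>0}^k$, $k\ge e$. For $0\le s\le e-1$ let $\rho^s=(\rho_{s+1},\dots,\rho_e)$, $\mathbf a^s=(a_{s+1},\dots,a_k)$; call $s$ feasible if $(\rho^s,\mathbf a^s)$ is feasible, and let $s^*$ be the minimal feasible index in $\{0,\dots,e-1\}$. Let $P_{j,r}=\frac1{r-j+1}\sum_{i=j}^r(\rho_i+a_i)$. Put $s_0=0$; as long as $s_j<s^*$, let $s_{j+1}=\max\{s_j<r\le s^*:P_{s_j+1,r}=\max_{s_j<i\le s^*}P_{s_j+1,i}\}$ and $c_{j+1}=P_{s_j+1,s_{j+1}}$; the procedure stops at some $q$ with $s_{q}=s^*$. Then $\mathcal N(\rho,\mathbf a)=\big(c_1\mathbf 1_{s_1},c_2\mathbf 1_{s_2-s_1},\dots,c_q\mathbf 1_{s_q-s_{q-1}},\nu(\rho^{s^*},\mathbf a^{s^*})\big)$ (just $\nu(\rho,\mathbf a)$ if $s^*=0$). *)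

(* Defs.v *)
From HB Require Import structures.
From mathcomp Require Import all_boot all_order all_algebra.
From mathcomp Require Import sesquilinear spectral.
From mathcomp Require Import boolp classical_sets reals.
From mathcomp Require Import complex.

Set Implicit Arguments.
Unset Strict Implicit.
Unset Printing Implicit Defensive.

Import Order.TTheory GRing.Theory Num.Theory.

Local Open Scope classical_set_scope.
Local Open Scope complex_scope.
Local Open Scope ring_scope.

(* A vector of R^n is represented by a sequence of size n, its coordinates
   being numbered from 0. *)

Section Vectors.
Variable R : realType.
Implicit Types (x y : seq R) (n : nat).

Definition decreasing x : bool := sorted >=%R x.

Definition desc x : seq R := sort >=%R x.

Definition asc x : seq R := sort <=%R x.

Definition tr x : R := \sum_(t <- x) t.

Definition addv x y : seq R := [seq p.1 + p.2 | p <- zip x y].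

Definition subv x y : seq R := [seq p.1 - p.2 | p <- zip x y].

Definition pad n x : seq R := x ++ nseq (n - size x) 0.

(* x is majorized by y; the shorter vector is completed with zeros *)
Definition majorized x y : bool :=
  let n := maxn (size x) (size y) in
  let x' := desc (pad n x) in
  let y' := desc (pad n y) in
  [forall j : 'I_n.+1, \sum_(i < j) x'`_i <= \sum_(i < j) y'`_i]
  && (tr x == tr y).

End Vectors.

(* Strict convexity and non-negativity on the half-line; the values of f at
   negative arguments are never used. *)
Definition strictly_convex (R : realType) (f : R -> R) : Prop :=
  (forall x, 0 <= x -> 0 <= f x) /\
  (forall x y t : R, 0 <= x -> 0 <= y -> x != y -> 0 < t < 1 ->
     f (t * x + (1 - t) * y) < t * f x + (1 - t) * f y).

Section Optimization.
Variable R : realType.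
Implicit Types (f : R -> R) (rho a gamma : seq R).

Definition Gamma (e : nat) a : set (seq R) :=
  [set gamma | [/\ size gamma = e, all (fun t => 0 <= t) gamma,
                   decreasing gamma & majorized a gamma]].

Definition minimizers f rho a : set (seq R) :=
  [set mu | Gamma (size rho) a mu /\
     forall gamma, Gamma (size rho) a gamma ->
       \sum_(t <- addv rho mu) f t <= \sum_(t <- addv rho gamma) f t].

(* For increasing non-negative rho and strictly convex f there is exactly one
   minimizer; the default value [::] has the wrong size unless rho = [::]. *)
Definition mu_opt f rho a : seq R := xget [::] (minimizers f rho a).

Definition nu_opt f rho a : seq R := addv rho (mu_opt f rho a).

End Optimization.

Section Construction.
Variable R : realType.
Implicit Types (rho a b : seq R) (s r n : nat).

Definition level rho b s : R := (tr b + tr (take s rho)) / s%:R.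

(* With 1-based indices, rho_s and rho_(s+1) are rho`_s.-1 and rho`_s. *)
Definition is_cut rho b s : bool := rho`_s.-1 <= level rho b s < rho`_s.

(* The index s in {1, ..., e-1}, unique when it is needed, is read off as the
   first element of the list of all such indices. *)
Definition nu_feas rho b : seq R :=
  let e := size rho in
  let t := tr rho + tr b in
  if rho`_e.-1 <= t / e%:R then nseq e (t / e%:R)
  else let s := head 0%N [seq s <- iota 1 e.-1 | is_cut rho b s] in
       nseq s (level rho b s) ++ drop s rho.

Definition feasible rho b : bool := majorized b (subv (nu_feas rho b) rho).

Definition feasible_index rho a s : bool := feasible (drop s rho) (drop s a).

(* the minimal feasible index in {0, ..., e-1} *)
Definition sstar rho a : nat := find (feasible_index rho a) (iota 0 (size rho)).

(* P_{s+1,r}: the average of the r - s terms of 1-based indices s+1, ..., r *)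
Definition avg rho a s r : R :=
  (\sum_(s <= i < r) (rho`_i + a`_i)) / (r - s)%:R.

(* the largest r in {s+1, ..., s*} that maximizes P_{s+1,r} *)
Definition next_index rho a s : nat :=
  let m := sstar rho a in
  (\max_(r < m.+1 | (s < r)%N &&
       [forall i : 'I_m.+1, (s < i)%N ==> (avg rho a s i <= avg rho a s r)%R]) r)%N.

(* the blocks c_{j+1}, c_{j+2}, ... obtained by iterating the procedure from
   s = s_j; n bounds the number of iterations *)
Fixpoint blocks rho a n s : seq R :=
  if n is n'.+1 then
    if (s < sstar rho a)%N then
      let s' := next_index rho a s in
      nseq (s' - s) (avg rho a s s') ++ blocks rho a n' s'
    else [::]
  else [::].

(* At most s* iterations are needed, the indices s_j being increasing. *)
Definition Ncal rho a : seq R :=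
  let s := sstar rho a in
  blocks rho a s 0 ++ nu_feas (drop s rho) (drop s a).

End Construction.

Section Frames.
Variables (R : realType) (d : nat).
Implicit Types (x y z : 'rV[R[i]]_d) (F : seq 'rV[R[i]]_d) (S : 'M[R[i]]_d).

(* Elements of C^d are row vectors, on which matrices act on the right;
   [dotmx] is the inner product of C^d, linear in its first argument. *)
Definition rank_one x y : 'M[R[i]]_d := map_mx Num.conj y^T *m x.

Lemma rank_oneE x y z : z *m rank_one x y = dotmx z y *: x.
Proof. by rewrite /rank_one mulmxA [z *m _]mx11_scalar mul_scalar_mx dotmxE. Qed.

Definition frame_op F : 'M[R[i]]_d := \sum_(x <- F) rank_one x x.

(* The eigenvalues of S with multiplicity, in the order chosen by
   [spectral_diag]; meaningful for Hermitian S, whose eigenvalues are real. *)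
Definition eigenvalues S : seq R :=
  [seq complex.Re (spectral_diag S 0 j) | j <- enum 'I_d].

Definition eig_desc S : seq R := desc (eigenvalues S).

Definition eig_asc S : seq R := asc (eigenvalues S).

Definition completions (F0 : seq 'rV[R[i]]_d) (k : nat) (a : k.-tuple R) :
    set (seq 'rV[R[i]]_d) :=
  [set F | exists G : k.-tuple 'rV[R[i]]_d,
     (forall j, dotmx (tnth G j) (tnth G j) = (tnth a j)%:C) /\ F = F0 ++ G].

Definition Lambda (F0 : seq 'rV[R[i]]_d) (k : nat) (a : k.-tuple R) :
    set (seq R) :=
  [set eig_desc (frame_op F) | F in completions F0 a].

End Frames.

(* Main.v *)
From Pilot Require Import Defs.
From mathcomp Require Import all_boot all_order all_algebra perm.
From mathcomp Require Import sesquilinear spectral.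
From mathcomp Require Import boolp classical_sets reals.
From mathcomp Require Import complex ring lra zify.

Import Order.TTheory GRing.Theory Num.Theory.
Import Pilot.Defs.
Local Open Scope ring_scope.

(** Every completion adds to S = frame_op F0 an operator built from k vectors
    of squared norms a_1, ..., a_k.  Let rho be the increasing spectrum of S,
    and write x^+ for max(x, 0).  The proof compares the explicit vector
    nu = (N(rho_1..rho_k, a), rho_(k+1), ..., rho_d) with its competitors y
    through their hinge sums, the numbers sum_j (y_j - t)^+ for real t: for
    two vectors of the same size and sum, inequality of all hinge sums is
    majorization ([hinge_majorizes]).

    Lower bound for the competitors.  For all t and all p <= k,
      sum_(i<=p) (rho_i + a_i - t) + sum_(i>p) (rho_i - t)^+
        <= sum_j (y_j - t)^+.
    When y = rho + gamma with gamma in Gamma_d(a), this is the inequality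
    a_1 + ... + a_p <= gamma_1 + ... + gamma_p ([optimal_hinge_Gamma]).  When y
    is the spectrum of a completion, one compresses S and the completed
    operator to the span of the eigenvectors of S with eigenvalue above t and
    of the first p added vectors ([eigenvalues_hinge]).

    Upper bound for nu.  The blocks of N are the slopes of the least concave
    majorant of the partial sums of rho + a, up to the index s*; beyond s*, N
    fills rho with water up to a level c, that is, N_i = max(c, rho_i).  If
    t >= c, the entries of N above t before s* form an initial segment that
    ends where the majorant touches the partial sums; if t < c, all entries
    exceed t.  In both cases the hinge sum of nu is at most the left-hand side
    above for a suitable p ([Ncal_spec], [optimal_hinge]).  The only delicate
    point is that the last block does not lie below the water level; this is
    where the minimality of s* enters ([level_lt_average]).

    Hence nu is majorized by every competitor.  By Karamata's inequality it
    minimizes the sum of f over rho + Gamma_d(a) for every convex f, and by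
    strict convexity the minimizer is unique, so nu_opt f = nu whatever f is
    ([nu_opt_explicit]).  The same comparison with spectra is the last claim
    ([optimal_least]).  Finally nu is attained: taking the added operator
    diagonal in an eigenbasis of S, with eigenvalues nu - rho, the Schur-Horn
    theorem provides a frame for it with the prescribed norms
    ([optimal_attained]).  Karamata's inequality and the Schur-Horn theorem both
    follow from the Hardy-Littlewood-Polya principle that a majorized vector is
    reached by transfers between two coordinates ([transfer_ind]). *)

(** * Majorization *)

Section Majorization.
Context {R : realType}.
Implicit Types (x y z s : seq R) (t c u v w : R).

Definition pos t : R := Num.max t 0.

Lemma pos_ge0 t : 0 <= pos t.
Proof. by rewrite /pos le_max lexx orbT. Qed.

Lemma le_pos t : t <= pos t.
Proof. by rewrite /pos le_max lexx. Qed.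

Lemma ge0_pos t : 0 <= t -> pos t = t.
Proof. by move=> t0; rewrite /pos max_l. Qed.

Lemma le0_pos t : t <= 0 -> pos t = 0.
Proof. by move=> t0; rewrite /pos max_r. Qed.

Lemma pos_mono u v : u <= v -> pos u <= pos v.
Proof. by move=> uv; rewrite /pos ge_max !le_max lexx orbT uv. Qed.

Lemma tr_nil : tr [::] = 0 :> R. Proof. by rewrite /tr big_nil. Qed.
Lemma tr_cons u s : tr (u :: s) = u + tr s.
Proof. by rewrite /tr big_cons. Qed.
Lemma tr_cat x y : tr (x ++ y) = tr x + tr y.
Proof. by rewrite /tr big_cat. Qed.
Lemma tr_nseq n u : tr (nseq n u) = n%:R * u.
Proof. by rewrite /tr big_nseq iter_addr_0 mulr_natl. Qed.
Lemma tr_perm x y : perm_eq x y -> tr x = tr y.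
Proof. exact: perm_big. Qed.

Lemma sum_nth_take x j : \sum_(i < j) x`_i = tr (take j x).
Proof.
elim: x j => [|u x IH] [|j]; rewrite ?take0 ?tr_nil ?big_ord0 //.
  by rewrite big1 // => i _; rewrite nth_nil.
by rewrite big_ord_recl /= tr_cons -IH.
Qed.

Lemma decreasing_pairwise x : decreasing x = pairwise >=%R x.
Proof. by apply: sorted_pairwise => u v w uv wu; apply: le_trans wu uv. Qed.

Lemma nth_decreasing x i j :
  decreasing x -> (i <= j)%N -> (j < size x)%N -> x`_j <= x`_i.
Proof.
move=> xd ij jx; apply: (@sorted_leq_nth _ >=%R) (ij) => //.
- by move=> u v w uv wu; apply: le_trans wu uv.
- by move=> u /=.
- by rewrite inE (leq_ltn_trans ij).
Qed.

Lemma sorted_desc x : decreasing (desc x).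
Proof. by apply: sort_sorted => u v; apply: le_total. Qed.

Lemma perm_desc x : perm_eq (desc x) x.
Proof. by rewrite perm_sort. Qed.

Lemma desc_id x : decreasing x -> desc x = x.
Proof. by apply: sorted_sort => u v w uv wu; apply: le_trans wu uv. Qed.

Lemma nth_pad n x i : (pad n x)`_i = x`_i.
Proof.
rewrite /pad nth_cat; case: ltnP => // le; rewrite nth_nseq if_same.
by rewrite nth_default.
Qed.

Lemma decreasing_pad n x :
  decreasing x -> all (fun t => 0 <= t) x -> decreasing (pad n x).
Proof.
rewrite !decreasing_pairwise /pad pairwise_cat => -> x0; rewrite /= andbC.
apply/andP; split; first elim: (n - _)%N => //= m IH.
  rewrite IH andbT.
  by apply/allP => t; rewrite mem_nseq => /andP[_ /eqP->] /=.
by apply/allrelP => u v ux; rewrite mem_nseq => /andP[_ /eqP->]; apply: (allP x0).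
Qed.

(** On decreasing non-negative vectors, padding with zeros and sorting change
    nothing, so that majorization can be read off the partial sums. *)
Lemma majorizedP x y :
  decreasing x -> decreasing y ->
  all (fun t => 0 <= t) x -> all (fun t => 0 <= t) y ->
  majorized x y <->
    (forall j, tr (take j x) <= tr (take j y)) /\ tr x = tr y.
Proof.
move=> xd yd x0 y0; rewrite /majorized !desc_id ?decreasing_pad //.
set n := maxn _ _.
have E j z : \sum_(i < j) (pad n z)`_i = tr (take j z).
  by rewrite -sum_nth_take; apply: eq_bigr => i _; rewrite nth_pad.
split=> [/andP[/forallP le /eqP eqt]|[le ->]].
  split=> // j; case: (ltnP j n.+1) => [jn|nj].
    by have := le (Ordinal jn); rewrite !E.
  rewrite !take_oversize ?eqt //; apply: leq_trans (ltnW nj).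
    exact: leq_maxr.
  exact: leq_maxl.
rewrite eqxx andbT; apply/forallP => j; rewrite !E; exact: le.
Qed.

Lemma tr_le_const s c : all (fun t => t <= c) s -> tr s <= (size s)%:R * c.
Proof.
elim: s => [|u s IH] /=; rewrite ?tr_nil ?mul0r // tr_cons => /andP[uc /IH].
by rewrite -natr1 mulrDl mul1r; lra.
Qed.

Lemma tr_ge_const s c : all (fun t => c <= t) s -> (size s)%:R * c <= tr s.
Proof.
elim: s => [|u s IH] /=; rewrite ?tr_nil ?mul0r // tr_cons => /andP[uc /IH].
by rewrite -natr1 mulrDl mul1r; lra.
Qed.

Lemma decreasing_cons u s :
  decreasing (u :: s) = all (fun t => t <= u) s && decreasing s.
Proof. by rewrite !decreasing_pairwise. Qed.

(** The Hardy-Littlewood-Polya principle, as an induction: a vector majorized by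
    [y] is reached from [y] by permutations and by transfers that replace two
    entries [u], [v] with [w], [u + v - w] between them.  One transfer between
    the two consecutive entries of [y] that surround the largest entry of [x]
    creates that entry; it is then removed from both vectors, which preserves
    majorization. *)
Lemma transfer_ind (Q : seq R -> Prop) :
  (forall s z, perm_eq s z -> Q s -> Q z) ->
  (forall u v w s, v <= w <= u -> Q [:: u, v & s] -> Q [:: w, u + v - w & s]) ->
  forall x y, size x = size y -> decreasing x -> decreasing y ->
    (forall j, tr (take j x) <= tr (take j y)) -> tr x = tr y -> Q y -> Q x.
Proof.
move=> Qperm Qtrans x; elim: x Q Qperm Qtrans => [|c x IH] Q Qperm Qtrans y.
  by move=> /esym/size0nil ->.
move=> sxy; rewrite decreasing_cons => /andP[xc xd] yd le eqt Qy.
pose Q' z := Q (c :: z).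
have Q'perm s z : perm_eq s z -> Q' s -> Q' z.
  by move=> st; apply: Qperm; rewrite perm_cons.
have Q'trans u v w s :
    v <= w <= u -> Q' [:: u, v & s] -> Q' [:: w, u + v - w & s].
  move=> vwu H; apply: (Qperm [:: w, u + v - w & c :: s]).
    exact: (permEl (perm_catCA [:: w; u + v - w] [:: c] s)).
  apply: Qtrans => //; apply: Qperm H.
  exact: (permEl (perm_catCA [:: c] [:: u; v] s)).
have takex j : (j <= size x)%N -> tr (take j x) <= j%:R * c.
  move=> jx; rewrite -[X in X%:R](size_takel jx); apply: tr_le_const.
  by apply/allP => v /mem_take vx; apply: (allP xc).
case yc: (has (fun t => t <= c) y); last first.
  (* all entries of y exceed those of x, which the traces forbid *)
  case: y sxy yd le eqt Qy yc => // y0 y [sxy] _ _ eqt _ /negbT.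
  rewrite -all_predC /= -ltNge => /andP[y0c yc].
  have := tr_le_const _ _ xc.
  have : (size y)%:R * c <= tr y.
    by apply: tr_ge_const; apply: sub_all yc => t /=; rewrite -ltNge => /ltW.
  by move: eqt; rewrite !tr_cons sxy; lra.
(* v is the first entry of y that does not exceed c, the largest one of x *)
have [y1 [v [y2 [Ey y1c vc]]]] :
    exists y1 v y2, [/\ y = y1 ++ v :: y2, all (fun t => c < t) y1 & v <= c].
  have yh := yc; move: yc; rewrite has_find => yc.
  exists (take (find (fun t => t <= c) y) y), (nth 0 y (find (fun t => t <= c) y)),
    (drop (find (fun t => t <= c) y).+1 y); split.
  - by rewrite -drop_nth // cat_take_drop.
  - apply/(all_nthP 0) => i; rewrite size_takel ?(ltnW yc) // => iy.
    by rewrite nth_take // ltNge (before_find 0 iy).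
  - exact: (nth_find 0 yh).
case/lastP: y1 Ey y1c => [|y1 u] Ey.
  (* the largest entries agree and can be removed *)
  move=> _; have {vc} Evc : v = c.
    apply/le_anti; rewrite vc; have := le 1%N.
    by rewrite Ey /= !take0 !tr_cons tr_nil !addr0.
  move: Ey sxy yd le eqt Qy; rewrite Evc => -> {y yc}.
  rewrite decreasing_cons /= => -[sxy] /andP[_ y2d] le eqt.
  move=> Qy; apply: (IH Q' Q'perm Q'trans _ _ xd _ _ _ Qy) => //.
    by move=> j; have := le j.+1; rewrite /= !tr_cons; lra.
  by move: eqt; rewrite !tr_cons; lra.
rewrite all_rcons => /andP[cu y1c].
rewrite -cats1 -catA /= in Ey.
move: sxy yd le eqt Qy; rewrite Ey => {y Ey yc} sxy yd le eqt Qy.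
move: yd; rewrite decreasing_pairwise pairwise_cat /= allrel_consr allrel_consr.
case/andP => /andP[y1u /andP[y1v y12]] /andP[y1p] /and3P[/andP[vu uy2] vy2 y2p].
have Qz : Q' (y1 ++ (u + v - c) :: y2).
  rewrite /Q'; apply: (Qperm [:: c, u + v - c & y1 ++ y2]).
    by rewrite perm_cons; exact: (permEl (perm_catCA [:: u + v - c] y1 y2)).
  apply: Qtrans; first by rewrite vc ltW.
  apply: Qperm Qy; exact: (permEl (perm_catCA y1 [:: u; v] y2)).
apply: (IH Q' Q'perm Q'trans _ _ xd _ _ _ Qz).
- by clear -sxy; move: sxy; rewrite !size_cat /=; lia.
- rewrite decreasing_pairwise pairwise_cat allrel_consr y12 y1p /= y2p.
  rewrite andbT andbT; apply/andP; split.
    by apply: sub_all y1u => t /= ut; lra.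
  by apply: sub_all vy2 => t /= ut; lra.
- (* before the modified entry, y dominates c and x' is dominated by c;
     after it, one more term is added on each side *)
  move=> j; rewrite take_cat; case: ltnP => [jy|yj].
    apply: le_trans (takex _ _) _.
      by clear -sxy jy; move: sxy; rewrite size_cat /=; lia.
    rewrite -[X in X%:R](size_takel (ltnW jy)); apply: tr_ge_const.
    by apply/allP => t /mem_take ty; apply/ltW/(allP y1c).
  case: (posnP (j - size y1)%N) => [E0|].
    rewrite E0 take0 cats0; have -> : j = size y1 by clear -E0 yj; lia.
    apply: le_trans (takex _ _) _; first by clear -sxy; move: sxy; rewrite size_cat /=; lia.
    by apply: tr_ge_const; apply: sub_all y1c => t /ltW.
  case Ej: (j - size y1)%N => [//|j'] _.
  have := le j.+1; rewrite take_cat ltnNge leqW //= subSn // Ej /=.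
  by rewrite !tr_cat !tr_cons; lra.
- by move: eqt; rewrite !(tr_cat, tr_cons); lra.
Qed.

(** Both [w] and [u + v - w] are convex combinations of [u] and [v], with
    exchanged weights. *)
Lemma convex_transfer (f : R -> R) u v w : strictly_convex f ->
  0 <= v -> v <= w <= u -> f w + f (u + v - w) <= f u + f v.
Proof.
move=> [_ fc] v0 /andP[vw wu].
have [->|vnw] := eqVneq w v; first by rewrite addrK addrC.
have [->|wnu] := eqVneq w u; first by rewrite [u + v]addrC addrK.
have vw' : v < w by rewrite lt_neqAle eq_sym vnw.
have wu' : w < u by rewrite lt_neqAle wnu.
have uv0 : 0 < u - v by lra.
pose t := (w - v) / (u - v).
have t01 : 0 < t < 1.
  by rewrite /t ltr_pdivrMr // mul1r divr_gt0 //; lra.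
have uv_neq : u - v != 0 by lra.
have E1 : t * u + (1 - t) * v = w by rewrite /t; field.
have E2 : t * v + (1 - t) * u = u + v - w by rewrite /t; field.
have := fc u v t; have := fc v u t; rewrite E1 E2.
have u0 : 0 <= u by lra.
have uv : u != v by lra.
move=> /(_ v0 u0 _ t01) H1 /(_ u0 v0 uv t01) H2.
have := H1 (_ : v != u); rewrite eq_sym => /(_ uv); lra.
Qed.

Lemma karamata (f : R -> R) x y : strictly_convex f ->
  all (fun t => 0 <= t) y -> size x = size y ->
  (forall j, tr (take j (desc x)) <= tr (take j (desc y))) -> tr x = tr y ->
  \sum_(t <- x) f t <= \sum_(t <- y) f t.
Proof.
move=> fc y0 sxy le eqt.
pose Q z := all (fun t => 0 <= t) z /\ \sum_(t <- z) f t <= \sum_(t <- y) f t.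
suff [_] : Q (desc x) by rewrite (perm_big _ (perm_desc x)).
apply: (transfer_ind Q) le _ _; rewrite ?sorted_desc //.
- move=> s z st [s0 fs]; split; first by rewrite -(perm_all _ st).
  by rewrite -(perm_big _ st).
- move=> u v w s vwu [/= /and3P[u0 v0 s0]]; rewrite !big_cons => fs.
  have := convex_transfer _ _ _ _ fc v0 vwu; case/andP: vwu => vw wu H.
  split; last by rewrite !big_cons; lra.
  by rewrite /= s0 andbT; apply/andP; split; lra.
- by rewrite !size_sort.
- by rewrite !(tr_perm _ _ (perm_desc _)).
- split; first by rewrite (perm_all _ (perm_desc y)).
  by rewrite (perm_big _ (perm_desc y)).
Qed.

Lemma sum_pos_ge s c : tr s - (size s)%:R * c <= \sum_(t <- s) pos (t - c).
Proof.
elim: s => [|u s IH]; rewrite ?big_nil ?tr_nil ?mul0r ?subr0 //=.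
rewrite big_cons tr_cons -natr1 mulrDl mul1r.
by have := le_pos (u - c); lra.
Qed.

(** For the sum of the [j] largest entries, take as threshold [c] the entry of
    index [j] of the sorted [y]: the hinge sum of [y] at [c] then counts exactly
    the [j] largest entries, while that of [x] is at least the sum of any [j]
    of the differences [t - c]. *)
Lemma hinge_majorizes x y : size x = size y -> tr x = tr y ->
  (forall c, \sum_(t <- x) pos (t - c) <= \sum_(t <- y) pos (t - c)) ->
  forall j, tr (take j (desc x)) <= tr (take j (desc y)).
Proof.
move=> sxy eqt hin j.
case: (ltnP j (size y)) => [jy|yj]; last first.
  by rewrite !take_oversize ?size_sort ?sxy // !(tr_perm _ _ (perm_desc _)) eqt.
have := hin ((desc y)`_j); set c := _`_j.
rewrite -(perm_big _ (perm_desc x)) -(perm_big _ (perm_desc y)) /=.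
rewrite -{1}(cat_take_drop j (desc x)) -{1}(cat_take_drop j (desc y)) !big_cat /=.
have := sum_pos_ge (take j (desc x)) c.
have : 0 <= \sum_(t <- drop j (desc x)) pos (t - c).
  by apply: sumr_ge0 => t _; apply: pos_ge0.
have dy := sorted_desc y.
have le_c i : (i < size y)%N -> (i <= j)%N -> c <= (desc y)`_i.
  by move=> iy ij; apply: nth_decreasing; rewrite ?size_sort.
have ge_c i : (i < size y)%N -> (j <= i)%N -> (desc y)`_i <= c.
  by move=> iy ij; apply: nth_decreasing; rewrite ?size_sort.
have -> : \sum_(t <- drop j (desc y)) pos (t - c) = 0.
  rewrite big1_seq // => t /andP[_ tdrop].
  case/(nthP 0): tdrop => i; rewrite size_drop size_sort nth_drop => ilt <-; rewrite le0_pos //.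
  by rewrite subr_le0 ge_c ?leq_addr // -ltn_subRL.
have sz z : size z = size y -> size (take j (desc z)) = j.
  by move=> zy; rewrite size_takel // size_sort zy ltnW.
have -> : \sum_(t <- take j (desc y)) pos (t - c) =
          tr (take j (desc y)) - j%:R * c.
  rewrite -[X in X%:R * c](sz y) //.
  have : all (fun t => c <= t) (take j (desc y)).
    apply/(all_nthP 0) => i; rewrite sz // => ij.
    by rewrite nth_take //; exact: le_c (ltn_trans ij jy) (ltnW ij).
  elim: (take _ _) => [|u s IH] /=; rewrite ?big_nil ?tr_nil ?mul0r ?subr0 //.
  case/andP => cu /IH; rewrite big_cons tr_cons -natr1 mulrDl mul1r => ->.
  by rewrite ge0_pos ?subr_ge0 //; ring.
by rewrite sz //; lra.
Qed.

Lemma hinge_majorized x y : size x = size y -> tr x = tr y ->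
  (forall c, \sum_(t <- x) pos (t - c) <= \sum_(t <- y) pos (t - c)) ->
  majorized (desc x) (desc y).
Proof.
move=> sxy eqt hin; rewrite /majorized !size_sort sxy maxnn.
rewrite /pad !size_sort sxy subnn !cats0 !(desc_id (desc _)) ?sorted_desc //.
rewrite !(tr_perm _ _ (perm_desc _)) eqt eqxx andbT.
by apply/forallP => j; rewrite !sum_nth_take; apply: hinge_majorizes.
Qed.

End Majorization.

(** * Water-filling *)

Section WaterFilling.
Context {R : realType}.
Implicit Types (x y z s rho a b : seq R) (t c u v w : R).

Lemma tr_drop i x : tr (drop i x) = \sum_(i <= j < size x) x`_j.
Proof.
elim: x i => [|u x IH] i; first by rewrite tr_nil big_geq.
case: i => [|i] /=; last by rewrite IH big_add1.
by rewrite big_nat_recl // tr_cons -{1}(drop0 x) IH.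
Qed.

Lemma tr_drop_split i m x : (i <= m <= size x)%N ->
  tr (drop i x) = \sum_(i <= j < m) x`_j + tr (drop m x).
Proof. by case/andP => im mx; rewrite !tr_drop -big_cat_nat. Qed.

Lemma tr_take_drop i x : tr x = tr (take i x) + tr (drop i x).
Proof. by rewrite -tr_cat cat_take_drop. Qed.

Lemma tr_take_sum i x : tr (take i x) = \sum_(0 <= j < i) x`_j.
Proof. by rewrite -sum_nth_take big_mkord. Qed.

Lemma nth_subv x y i : size x = size y -> (subv x y)`_i = x`_i - y`_i.
Proof.
elim: x y i => [|u x IH] [|v y] // i; first by rewrite !nth_nil subr0.
by case: i => [|i] //= [/IH].
Qed.

Lemma tr_subv x y : size x = size y -> tr (subv x y) = tr x - tr y.
Proof.
elim: x y => [|u x IH] [|v y] //= => [_|[/IH E]]; first by rewrite tr_nil subr0.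
by rewrite /subv /= !tr_cons -/(subv x y) E; ring.
Qed.

Lemma take_subv x y i : take i (subv x y) = subv (take i x) (take i y).
Proof.
elim: x y i => [|u x IH] [|v y] [|i] //=; rewrite /subv //= ?take0 //.
by congr cons; apply: IH.
Qed.

Lemma size_subv x y : size x = size y -> size (subv x y) = size x.
Proof. by move=> E; rewrite size_map size_zip E minnn. Qed.

(** The amount of water that covers each site when the level is [c]. *)
Definition fill c rho : seq R := [seq pos (c - r) | r <- rho].

Lemma subv_fill c rho : subv [seq Num.max c r | r <- rho] rho = fill c rho.
Proof.
elim: rho => [|r rho IH] //=; rewrite /subv /= -/(subv _ _) IH; congr cons.
case: (lerP c r) => cr; first by rewrite subrr le0_pos // subr_le0.
by rewrite ge0_pos // subr_ge0 ltW.
Qed.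

Lemma tr_map_max c rho : tr [seq Num.max c r | r <- rho] = tr rho + tr (fill c rho).
Proof. by rewrite -subv_fill tr_subv ?size_map //; ring. Qed.

Lemma increasing_pairwise x : sorted <=%R x = pairwise <=%R x.
Proof. by apply: sorted_pairwise => u v w; apply: le_trans. Qed.

Lemma nth_increasing x i j :
  sorted <=%R x -> (i <= j)%N -> (j < size x)%N -> x`_i <= x`_j.
Proof.
move=> xd ij jx; apply: (@sorted_leq_nth _ <=%R) (ij) => //.
- by move=> u v w uv wu; apply: le_trans wu.
- by rewrite inE (leq_ltn_trans ij).
Qed.

Lemma fill_decreasing c rho : sorted <=%R rho -> decreasing (fill c rho).
Proof.
rewrite increasing_pairwise decreasing_pairwise pairwise_map.
by apply: sub_pairwise => u v uv; apply: pos_mono; rewrite lerB.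
Qed.

Lemma fill_ge0 c rho : all (fun t => 0 <= t) (fill c rho).
Proof. by apply/allP => t /mapP[r _ ->]; apply: pos_ge0. Qed.

Lemma tr_fill_mono c w rho : c <= w -> tr (fill c rho) <= tr (fill w rho).
Proof.
move=> cw; rewrite /tr !big_map; apply: ler_sum => r _.
by apply: pos_mono; rewrite lerB.
Qed.

Lemma drop_fill i c rho : drop i (fill c rho) = fill c (drop i rho).
Proof. by rewrite /fill map_drop. Qed.

Lemma take_fill i c rho : take i (fill c rho) = fill c (take i rho).
Proof. by rewrite /fill map_take. Qed.

(** The level is not determined by the volume when no site is covered, so the
    two levels cannot be compared directly; if [w] is the higher one, the first
    [i] sites already hold at least as much water at level [w]. *)
Lemma tr_fill_drop c w rho i : tr (fill w rho) <= tr (fill c rho) ->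
  tr (fill w (drop i rho)) <= tr (fill c (drop i rho)).
Proof.
move=> le; have [/tr_fill_mono //|/ltW /(@tr_fill_mono _ _ (take i rho))] := lerP w c.
move: le; rewrite (tr_take_drop i (fill w rho)) (tr_take_drop i (fill c rho)).
by rewrite !take_fill !drop_fill; lra.
Qed.

Lemma fill_level_gt c rho : sorted <=%R rho -> 0 < tr (fill c rho) -> rho`_0 <= c.
Proof.
case: rho => [|r rho] srt; first by rewrite tr_nil ltxx.
have [//|cr] := lerP r c.
suff -> : tr (fill c (r :: rho)) = 0 by rewrite ltxx.
rewrite /tr /fill big_map big1_seq // => t /andP[_ trho]; rewrite le0_pos // subr_le0.
case/(nthP 0): trho => i irho <-; apply: le_trans (ltW cr) _.
exact: (nth_increasing (r :: rho) 0 i).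
Qed.

Lemma map_max_low c x : all (fun t => t <= c) x ->
  [seq Num.max c r | r <- x] = nseq (size x) c.
Proof. by elim: x => //= r x IH /andP[rc /IH ->]; rewrite max_l. Qed.

Lemma map_max_high c x : all (fun t => c <= t) x -> [seq Num.max c r | r <- x] = x.
Proof. by elim: x => //= r x IH /andP[rc /IH ->]; rewrite max_r. Qed.

Lemma levelK rho b (s : nat) : (0 < s)%N -> s%:R * level rho b s = tr b + tr (take s rho).
Proof. by move=> s0; rewrite /level mulrC divfK // pnatr_eq0 -lt0n. Qed.

(** The least [s >= 1] whose level lies below the next site is a cut: if
    [s > 1], the level at [s - 1] is at least [rho_s], hence so is the level at
    [s], an average of both; if [s = 1], the water poured raises the level above
    [rho_1]. *)
Lemma cut_exists rho b : sorted <=%R rho -> 0 < tr b ->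
  (tr rho + tr b) / (size rho)%:R < rho`_(size rho).-1 ->
  exists2 s, s \in iota 1 (size rho).-1 & is_cut rho b s.
Proof.
move=> srt b0; set e := size rho => high.
have e0 : (0 < e)%N.
  by rewrite lt0n; apply: contraTneq high => e0; rewrite e0 invr0 mulr0 nth_default ?ltxx // -/e e0.
have eR : 0 < e%:R :> R by rewrite ltr0n.
rewrite ltr_pdivrMr // in high.
have e1 : (1 < e)%N.
  case: (ltngtP 1%N e) => // [|e1]; first by case: (e) e0 => [|[]].
  move: high; rewrite -e1 mulr1 /= -[X in tr X](take_size rho) -/e -e1.
  by rewrite -(sum_nth_take rho) big_ord1 /=; lra.
have Pe1 : (0 < e.-1)%N && (level rho b e.-1 < rho`_e.-1).
  have e10 : (0 < e.-1)%N by rewrite -ltnS prednK.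
  rewrite e10 /=; have p0 : 0 < e.-1%:R :> R by rewrite ltr0n.
  rewrite -(ltr_pM2l p0) levelK //.
  move: high; rewrite -{1}(take_size rho) -/e -{1 3}(prednK e0) -sum_nth_take.
  by rewrite big_ord_recr /= sum_nth_take -natr1 mulrDr mulr1; lra.
case: (@ex_minnP (fun s : nat => (0 < s)%N && (level rho b s < rho`_s))).
  by exists e.-1.
move=> s /andP[s0 slt] smin; have se := smin _ Pe1.
exists s; first by rewrite mem_iota s0 /= add1n ltnS.
rewrite /is_cut slt andbT.
case: s s0 slt smin se => // -[_ _ _ _|s _ _ smin se] /=.
  by rewrite /level divr1 -sum_nth_take big_ord1 lerDr ltW.
have : rho`_s.+1 <= level rho b s.+1.
  rewrite leNgt; apply/negP => lt; have := smin s.+1; rewrite lt ltnn.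
  by move/(_ isT).
have q0 : 0 < s.+1%:R :> R by rewrite ltr0n.
have q1 : 0 < s.+2%:R :> R by rewrite ltr0n.
rewrite -(ler_pM2l q0) levelK // => le.
rewrite -(ler_pM2l q1) levelK // -sum_nth_take; move: le; rewrite -sum_nth_take.
by rewrite (big_ord_recr s.+1) /= -[s.+2%:R]natr1 mulrDl mul1r; lra.
Qed.

(** Both cases of the definition of [nu_feas], the constant vector and the one
    with a cut, are the surface of the water of volume [tr b] poured on
    [rho]. *)
Lemma nu_feas_water rho b : sorted <=%R rho -> rho != [::] -> 0 < tr b ->
  exists2 c, nu_feas rho b = [seq Num.max c r | r <- rho] &
             tr (fill c rho) = tr b.
Proof.
move=> srt rho0 b0; set e := size rho.
have e0 : (0 < e)%N by rewrite lt0n size_eq0.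
suff [c E Etr] : exists2 c, nu_feas rho b = [seq Num.max c r | r <- rho] &
             tr (nu_feas rho b) = tr rho + tr b.
  by exists c => //; move: Etr; rewrite E tr_map_max; lra.
rewrite /nu_feas -/e; set t := _ / _; case: lerP => [le|high].
  (* the level reaches the highest site *)
  exists t; last by rewrite tr_nseq /t mulrC divfK // pnatr_eq0 -lt0n.
  rewrite map_max_low //; apply/(all_nthP 0) => i ie; apply: le_trans le.
  by apply: nth_increasing; rewrite // -/e ?prednK // -ltnS prednK.
have [s siota scut] := cut_exists _ _ srt b0 high.
set l := [seq _ <- _ | _].
have : head 0%N l \in l.
  have : s \in l by rewrite mem_filter scut.
  by case: (l) => //= n l' _; rewrite mem_head.
rewrite mem_filter mem_iota => /andP[]; move: (head _ _) => {siota scut}s.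
case/andP=> lo hi /andP[s1 se]; set c := level rho b s.
rewrite add1n prednK // in se.
exists c.
  rewrite -{2}(cat_take_drop s rho) map_cat; congr cat.
    rewrite map_max_low ?size_takel ?(ltnW se) //.
    apply/(all_nthP 0) => i; rewrite size_takel ?(ltnW se) // => si.
    rewrite nth_take //; apply: le_trans lo; apply: nth_increasing => //.
      by rewrite -ltnS prednK.
    by rewrite prednK // ltnW.
  rewrite map_max_high //; apply/(all_nthP 0) => i; rewrite size_drop => si.
  rewrite nth_drop; apply: le_trans (ltW hi) _; apply: nth_increasing => //.
    exact: leq_addr.
  by rewrite -ltn_subRL.
by rewrite tr_cat tr_nseq levelK // [tr rho](tr_take_drop s); ring.
Qed.

Lemma size_fill c rho : size (fill c rho) = size rho.
Proof. exact: size_map. Qed.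

(** Feasibility is stated on final segments, since the water level of a
    problem has to be compared with those of its truncations. *)
Lemma feasibleP rho b c : sorted <=%R rho -> decreasing b ->
  all (fun t => 0 <= t) b ->
  nu_feas rho b = [seq Num.max c r | r <- rho] -> tr (fill c rho) = tr b ->
  feasible rho b <-> forall j, tr (fill c (drop j rho)) <= tr (drop j b).
Proof.
move=> srt bd b0 E Etr; rewrite /feasible E subv_fill.
have -> := majorizedP b (fill c rho) bd (fill_decreasing _ _ srt) b0 (fill_ge0 _ _).
have eqv j : tr (take j b) + tr (drop j b) =
             tr (take j (fill c rho)) + tr (fill c (drop j rho)).
  by rewrite -drop_fill -!tr_take_drop.
split=> [[le _] j|le]; first by have := le j; have := eqv j; lra.
by split=> // j; have := le j; have := eqv j; lra.
Qed.


End WaterFilling.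

(** * Blocks of constant average *)

Ltac nat_lia :=
  repeat match goal with
  | H : ?P |- _ => match P with context [Real.sort] => clear H end
  end; lia.

Section Blocks.
Context {R : realType}.
Variables rho a : seq R.
Implicit Types (z : seq R) (t c : R) (i j p r s n : nat).
Let m := sstar rho a.
Let B s r : R := \sum_(s <= i < r) (rho`_i + a`_i).

Lemma blocksum_split s r j : (s <= r <= j)%N -> B s j = B s r + B r j.
Proof. by case/andP => sr rj; rewrite /B -big_cat_nat. Qed.

Lemma avgK s r : (s < r)%N -> (r%:R - s%:R) * avg rho a s r = B s r.
Proof.
move=> sr; rewrite -natrB ?(ltnW sr) // /avg mulrC divfK //.
by rewrite pnatr_eq0 -lt0n subn_gt0.
Qed.

Lemma next_indexP s : (s < m)%N ->
  (s < next_index rho a s <= m)%N /\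
  forall i, (s < i <= m)%N -> avg rho a s i <= avg rho a s (next_index rho a s).
Proof.
move=> sm; rewrite /next_index -/m.
pose P (r : 'I_m.+1) := (s < r)%N &&
  [forall i : 'I_m.+1, (s < i)%N ==> (avg rho a s i <= avg rho a s r)].
pose i0 : 'I_m.+1 := ord_max.
pose r0 := [arg max_(r > i0 | (s < r)%N) avg rho a s r]%O.
have [P0 r0max] : (s < r0)%N /\ forall i : 'I_m.+1, (s < i)%N ->
    avg rho a s i <= avg rho a s r0.
  by rewrite /r0; case: Order.TotalTheory.arg_maxP => //= r sr rmax; split.
have Pr0 : P r0.
  by rewrite /P P0 /=; apply/forallP => i; apply/implyP; apply: r0max.
have cardP : (0 < #|P|)%N by apply/card_gt0P; exists r0.
rewrite -/(\max_(r < m.+1 | P r) r).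
have [r /andP[sr /forallP rmax] ->] := eq_bigmax_cond (fun r : 'I_m.+1 => r : nat) cardP.
split; first by rewrite sr -ltnS ltn_ord.
move=> i /andP[si im]; have im' : (i < m.+1)%N by rewrite ltnS.
by have /implyP := rmax (Ordinal im'); apply.
Qed.

(** The properties of the least concave majorant of the partial sums of
    [rho + a] between [s] and [s*]: its slopes decrease, they do not exceed the
    largest average, it dominates the partial sums and has the same end point,
    and its part of slope above [t] ends at a contact point.  The last clause
    holds because each slope, being the largest average from its starting
    point, is at least the average from there to [s*]. *)
Lemma blocks_spec n s (z := blocks rho a n s) : (s <= m)%N -> (m - s <= n)%N ->
  [/\ size z = (m - s)%N /\ decreasing z,
      forall t, (forall r, (s < r <= m)%N -> avg rho a s r <= t) ->
        all (fun x => x <= t) z,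
      (forall j, (s + j <= m)%N -> B s (s + j) <= tr (take j z)) /\ tr z = B s m,
      forall t, exists2 p, (s + p <= m)%N &
        \sum_(x <- z) pos (x - t) <= B s (s + p) - p%:R * t &
      forall c, (forall i, (s <= i < m)%N -> (m%:R - i%:R) * c < B i m) ->
        all (fun x => c <= x) z].
Proof.
rewrite {}/z; elim: n s => [|n IH] s sm msn; rewrite /= -/m.
  have -> : s = m by nat_lia.
  split=> //=.
  - by rewrite subnn.
  - split=> [j|]; last by rewrite tr_nil /B big_geq.
    by case: j => [|j]; [rewrite /B addn0 big_geq // tr_nil|nat_lia].
  - by exists 0%N; rewrite ?addn0 // big_nil /B big_geq // mul0r subr0.
case: ltnP => [slt|ms]; last first.
  have -> : s = m by nat_lia.
  split=> //=.
  - by rewrite subnn.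
  - split=> [j|]; last by rewrite tr_nil /B big_geq.
    by case: j => [|j]; [rewrite /B addn0 big_geq // tr_nil|nat_lia].
  - by exists 0%N; rewrite ?addn0 // big_nil /B big_geq // mul0r subr0.
have [/andP[] ] := next_indexP _ slt.
set s' := next_index rho a s; set C := avg rho a s s' => ss' s'm Cmax.
have [|[IHsize IHdec] IHle [IHsum IHtr] IHpos IHge] := IH s' s'm; first nat_lia.
set z := blocks rho a n s' in IHsize IHdec IHle IHsum IHtr IHpos IHge *.
have Rss' : s%:R < s'%:R :> R by rewrite ltr_nat.
have BC : B s s' = (s'%:R - s%:R) * C by rewrite avgK.
have BCle i : (s < i <= m)%N -> B s i <= (i%:R - s%:R) * C.
  move=> /andP[si im]; rewrite -avgK // ler_wpM2l ?Cmax ?si //.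
  by rewrite subr_ge0 ler_nat ltnW.
(* the average of the first block is maximal, so no later average exceeds it *)
have zC : all (fun x => x <= C) z.
  apply: IHle => r /andP[s'r rm].
  have p0 : 0 < r%:R - s'%:R :> R by rewrite subr_gt0 ltr_nat.
  rewrite -(ler_pM2l p0) avgK //.
  have := BCle r; rewrite (blocksum_split s s' r) ?(ltnW s'r) ?(ltnW ss') // BC.
  by rewrite rm (ltn_trans ss' s'r) => /(_ isT); lra.
split.
- split; first by rewrite size_cat size_nseq IHsize; nat_lia.
  rewrite decreasing_pairwise pairwise_cat -!decreasing_pairwise IHdec andbT.
  apply/andP; split.
    by apply/allrelP => x y; rewrite mem_nseq => /andP[_ /eqP->]; apply: (allP zC).
  rewrite decreasing_pairwise; apply/(pairwiseP 0) => i j.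
  by rewrite !inE size_nseq => iss jss _ /=; rewrite !nth_nseq iss jss.
- move=> t tmax; have Ct : C <= t by apply: tmax; rewrite ss'.
  rewrite all_cat all_nseq Ct orbT /=; apply: sub_all zC => x /= xC.
  exact: le_trans Ct.
- split; last first.
    rewrite tr_cat tr_nseq IHtr (blocksum_split s s' m) ?(ltnW ss') // BC natrB //.
    exact: ltnW.
  move=> j sj; rewrite take_cat size_nseq; case: ltnP => [jlt|jge].
    rewrite take_nseq ?(ltnW jlt) // tr_nseq.
    case: j sj jlt => [|j] sj jlt; first by rewrite /B addn0 big_geq // mul0r.
    apply: le_trans (BCle _ _) _; first by rewrite sj andbT; nat_lia.
    by rewrite natrD addrAC subrr add0r.
  have [j' Ej] : exists j', (s + j = s' + j')%N by exists (s + j - s')%N; nat_lia.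
  have -> : (j - (s' - s) = j')%N by nat_lia.
  rewrite tr_cat tr_nseq Ej (blocksum_split s s') ?leq_addr ?(ltnW ss') //.
  rewrite BC natrB ?(ltnW ss') // lerD2l; apply: IHsum; nat_lia.
- move=> t; have [tC|Ct] := ltP t C.
    have [p pm le] := IHpos t; exists (s' - s + p)%N; first nat_lia.
    have -> : (s + (s' - s + p) = s' + p)%N by nat_lia.
    rewrite (blocksum_split s s') ?leq_addr ?(ltnW ss') // BC big_cat /=.
    rewrite big_nseq iter_addr_0 -[pos _ *+ _]mulr_natl natrD natrB ?(ltnW ss') //.
    by rewrite (ge0_pos (C - t)) ?subr_ge0 ?(ltW tC) //; lra.
  (* no slope exceeds t *)
  exists 0%N; rewrite ?addn0 // /B big_geq // mul0r subr0.
  rewrite big1_seq // => x /andP[_ xz]; rewrite le0_pos // subr_le0.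
  apply: le_trans Ct; move: xz; rewrite mem_cat mem_nseq => /orP[/andP[_ /eqP->]//|].
  exact: (allP zC).
- move=> c clt; rewrite all_cat all_nseq; apply/andP; split; last first.
    by apply: IHge => i /andP[si im]; apply: clt; rewrite im andbT (leq_trans (ltnW ss')).
  apply/orP; right; apply: ltW.
  have p0 : 0 < m%:R - s%:R :> R by rewrite subr_gt0 ltr_nat.
  rewrite -(ltr_pM2l p0); apply: lt_le_trans (clt s _) _; first by rewrite leqnn.
  by apply: BCle; rewrite slt leqnn.
Qed.

End Blocks.

(** * The vector produced by the construction *)

Section Construction.
Context {R : realType}.
Variables rho a : seq R.
Hypothesis rho_incr : sorted <=%R rho.
Hypothesis a_decr : decreasing a.
Hypothesis a_pos : all (fun t => 0 < t) a.
Hypothesis size_rho : size rho = size a.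
Let k := size a.
Let m := sstar rho a.
Implicit Types (t c : R) (i j p u v : nat).

Lemma drop_incr i : sorted <=%R (drop i rho).
Proof. exact: drop_sorted. Qed.

Lemma drop_decr i : decreasing (drop i a).
Proof. exact: drop_sorted. Qed.

Lemma drop_ge0 i : all (fun t => 0 <= t) (drop i a).
Proof. by apply/allP => t /mem_drop ta; apply/ltW/(allP a_pos). Qed.

Lemma tr_drop_gt0 i : (i < k)%N -> 0 < tr (drop i a).
Proof.
move=> ik; rewrite (drop_nth 0) // tr_cons ltr_pwDl //.
  by apply: (all_nthP 0 a_pos).
by rewrite /tr big_seq; apply: sumr_ge0 => t; apply: (allP (drop_ge0 _)).
Qed.

Lemma water_level i : (i < k)%N -> exists c,
  [/\ nu_feas (drop i rho) (drop i a) = [seq Num.max c r | r <- drop i rho],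
      tr (fill c (drop i rho)) = tr (drop i a) &
      feasible_index rho a i <-> forall j, (i <= j)%N ->
        tr (fill c (drop j rho)) <= tr (drop j a)].
Proof.
move=> ik; have [|c E Etr] := @nu_feas_water R _ _ (drop_incr i) _ (tr_drop_gt0 _ ik).
  by rewrite -size_eq0 size_drop size_rho subn_eq0 -ltnNge.
exists c; split=> //; rewrite /feasible_index.
rewrite (feasibleP _ _ c) ?drop_incr ?drop_decr ?drop_ge0 //.
split=> [le j ij|le j]; last by rewrite !drop_drop; apply: le; rewrite leq_addl.
by have := le (j - i)%N; rewrite !drop_drop subnK.
Qed.

(** With a single site left, the water is exactly the single remaining norm. *)
Lemma feasible_last : (0 < k)%N -> feasible_index rho a k.-1.
Proof.
move=> k0; have [|c [_ Etr ->]] := water_level k.-1; first by rewrite prednK.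
move=> j; rewrite leq_eqVlt => /orP[/eqP<-|]; first by rewrite Etr.
by rewrite prednK // => kj; rewrite !drop_oversize ?size_rho.
Qed.

Lemma sstarP : (0 < k)%N ->
  [/\ (m < k)%N, feasible_index rho a m &
      forall i, (i < m)%N -> ~ feasible_index rho a i].
Proof.
move=> k0; have hasf : has (feasible_index rho a) (iota 0 (size rho)).
  apply/hasP; exists k.-1; last exact: feasible_last.
  by rewrite mem_iota size_rho /= prednK.
have mk : (m < k)%N by have := hasf; rewrite has_find size_iota /k -size_rho.
have nthm : nth 0%N (iota 0 (size rho)) m = m by rewrite nth_iota ?size_rho.
split=> //; first by have := nth_find 0%N hasf; rewrite -/(sstar rho a) -/m nthm.
move=> i im; have := before_find 0%N im.
by rewrite nth_iota ?size_rho ?(ltn_trans im) // => ->.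
Qed.

Let B s r : R := \sum_(s <= i < r) (rho`_i + a`_i).

Section Level.
Variable c : R.
Hypothesis mk : (m < k)%N.
Hypothesis tr_level : tr (fill c (drop m rho)) = tr (drop m a).

Lemma rho_le_level i : (i <= m)%N -> rho`_i <= c.
Proof.
move=> im; have := fill_level_gt c _ (drop_incr m).
rewrite tr_level tr_drop_gt0 // nth_drop addn0 => /(_ isT).
by apply: le_trans; apply: nth_increasing; rewrite // size_rho.
Qed.

(** Below [s*] every site is covered at level [c], which makes the surplus of
    water over the supply from [i] on linear in [c]. *)
Lemma fill_surplus i : (i <= m)%N ->
  tr (fill c (drop i rho)) - tr (drop i a) = (m%:R - i%:R) * c - B i m.
Proof.
move=> im; rewrite -drop_fill.
rewrite (tr_drop_split i m) ?size_fill ?size_rho ?im 1?ltnW //.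
rewrite (tr_drop_split i m a) ?im 1?ltnW // drop_fill tr_level.
have -> : \sum_(i <= j < m) (fill c rho)`_j = \sum_(i <= j < m) (c - rho`_j).
  apply: eq_big_nat => j /andP[_ jm].
  rewrite (nth_map 0) ?size_rho ?(ltn_trans jm) // ge0_pos // subr_ge0.
  by rewrite rho_le_level // ltnW.
rewrite sumrB sumr_const_nat -[c *+ _]mulr_natl natrB // /B big_split /=; ring.
Qed.

Hypothesis level_feas : forall j, (m <= j)%N ->
  tr (fill c (drop j rho)) <= tr (drop j a).
Hypothesis infeas : forall i, (i < m)%N -> ~ feasible_index rho a i.

(** The minimality of [s*] puts the blocks above the water level: if some final
    average were at most [c], the last such index [u] would be feasible.
    Indeed the supply from [u] on does not exceed the water at level [c], so the
    level [w] of the problem at [u] leaves on each final segment at most the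
    water at level [c]; on the segments starting strictly between [u] and [s*]
    this is covered by the supply because their averages exceed [c], and on
    those starting later because [s*] is feasible. *)
Lemma level_lt_average i : (i < m)%N -> (m%:R - i%:R) * c < B i m.
Proof.
move=> im; rewrite ltNge; apply/negP => lei.
pose P j := (j < m)%N && (B j m <= (m%:R - j%:R) * c).
have exP : exists j, P j by exists i; rewrite /P im lei.
have ubP j : P j -> (j <= m)%N by case/andP => /ltnW.
case: (ex_maxnP exP ubP) => u /andP[um leu] umax.
have [w [_ Ew feasw]] := water_level u (ltn_trans um mk).
apply: (infeas _ um); rewrite feasw => j; rewrite leq_eqVlt => /orP[/eqP<-|uj].
  by rewrite Ew.
have wc : tr (fill w (drop u rho)) <= tr (fill c (drop u rho)).
  by rewrite Ew; have := fill_surplus u (ltnW um); lra.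
have := tr_fill_drop _ _ _ (j - u)%N wc; rewrite drop_drop subnK 1?ltnW //.
move/le_trans; apply.
case: (ltnP j m) => [jm|]; last exact: level_feas.
have : ~~ P j by apply/negP => /umax; rewrite leqNgt uj.
rewrite /P jm /= -ltNge => ltj; have := fill_surplus j (ltnW jm); lra.
Qed.

End Level.

Let nu := Ncal rho a.

(** All clauses but the last make [nu - rho] an admissible increment; it is
    decreasing because [nu] decreases up to the point where it meets [rho].
    In the last clause, [p] is a contact point of the concave majorant when [t]
    is at least the water level, and [p = k] otherwise. *)
Lemma Ncal_spec :
  [/\ size nu = k,
      decreasing (subv nu rho) /\ all (fun t => 0 <= t) (subv nu rho),
      forall j, tr (take j a) + tr (take j rho) <= tr (take j nu),
      tr nu = tr rho + tr a &
      forall t, exists2 p, (p <= k)%N &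
        \sum_(x <- nu) pos (x - t) <= tr (take p rho) + tr (take p a) - p%:R * t
          + \sum_(x <- drop p rho) pos (x - t)].
Proof.
rewrite /nu; case: (posnP k) => [/size0nil a0|k0].
  have rho0 : rho = [::] by apply: size0nil; rewrite size_rho a0.
  have -> : Ncal rho a = [::].
    by rewrite a0 rho0 /Ncal /= /nu_feas /=; case: ifP.
  rewrite /k a0 rho0; split=> //.
  - by move=> j; rewrite !tr_nil addr0.
  - by rewrite !tr_nil addr0.
  - by move=> t; exists 0%N; rewrite // !big_nil !tr_nil mul0r !(addr0, subr0).
have [mk feasm infeas] := sstarP k0.
have [c [Enu Etr [/(_ feasm) lec _]]] := water_level m mk.
have rhoc i : (i <= m)%N -> rho`_i <= c by exact: (rho_le_level _ mk Etr).
have clt i : (i < m)%N -> (m%:R - i%:R) * c < B i m.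
  exact: (level_lt_average _ mk Etr lec infeas).
have [||[zsize zdec] _ [zsum ztr] zpos zge] := blocks_spec rho a m 0.
- by [].
- by rewrite subn0.
rewrite /Ncal -/m Enu; set z := blocks rho a m 0 in zsize zdec zsum ztr zpos zge *.
rewrite subn0 in zsize.
set q := [seq Num.max c r | r <- drop m rho].
have zc : all (fun x => c <= x) z by apply: zge => i /andP[_ im]; apply: clt.
have qc : all (fun x => c <= x) q.
  by apply/allP => x /mapP[r _ ->]; rewrite le_max lexx.
have size_q : size q = (k - m)%N by rewrite size_map size_drop size_rho.
have size_nu : size (z ++ q) = k by rewrite size_cat zsize size_q subnKC // ltnW.
have size_nu_rho : size (z ++ q) = size rho by rewrite size_nu size_rho.
have Br i : B 0 i = tr (take i rho) + tr (take i a).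
  by rewrite /B big_split /= !tr_take_sum.
have tr_nu : tr (z ++ q) = tr rho + tr a.
  rewrite tr_cat ztr -/(B 0 m) Br.
  by rewrite tr_map_max Etr (tr_take_drop m rho) (tr_take_drop m a); lra.
have nu_z i : (i < m)%N -> (z ++ q)`_i = z`_i by move=> im; rewrite nth_cat zsize im.
have nu_q i : (m <= i < k)%N -> (z ++ q)`_i = Num.max c rho`_i.
  case/andP => mi ik; rewrite nth_cat zsize ltnNge mi /=.
  by rewrite (nth_map 0) ?nth_drop ?subnKC // size_drop size_rho; nat_lia.
have nu_ge i : (i < k)%N -> rho`_i <= (z ++ q)`_i.
  move=> ik; case: (ltnP i m) => im; last by rewrite nu_q ?im // le_max lexx orbT.
  rewrite nu_z //; apply: le_trans (rhoc _ (ltnW im)) _.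
  by apply: (all_nthP 0 zc); rewrite zsize.
split=> //.
- split; last first.
    apply/(all_nthP 0) => i; rewrite size_subv // size_nu => ik.
    by rewrite nth_subv // subr_ge0 nu_ge.
  apply/(sortedP 0) => i; rewrite size_subv // size_nu => ik.
  rewrite !nth_subv //=.
  have rr : rho`_i <= rho`_i.+1 by apply: nth_increasing; rewrite // size_rho.
  have ik' := ltnW ik; case: (ltngtP i.+1 m) => [im|im|im].
  (* both indices in the blocks, both under the water rule, or one of each *)
  + rewrite !nu_z ?(ltnW im) //.
    have : z`_i.+1 <= z`_i by apply: nth_decreasing; rewrite // zsize.
    by lra.
  + rewrite nu_q ?ik ?(ltnW im) // nu_q ?ik' ?andbT //.
    by case: (lerP c rho`_i) => ci; case: (lerP c rho`_i.+1) => ci'; lra.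
  + rewrite nu_q ?ik ?im ?leqnn // max_l ?rhoc ?im // nu_z -?im //.
    have : c <= z`_i by apply: (all_nthP 0 zc); rewrite zsize -/m -im.
    by lra.
- move=> j; case: (leqP j m) => jm.
    rewrite take_cat zsize; case: ltnP => [_|mj].
      by rewrite addrC -Br; exact: (zsum j).
    have -> : j = m by apply/eqP; rewrite eqn_leq jm.
    by rewrite subnn take0 cats0 ztr -/(B 0 m) Br addrC.
  rewrite take_cat zsize ltnNge (ltnW jm) /= tr_cat ztr -/(B 0 m) Br.
  have := tr_take_drop (j - m) q; rewrite {1 3}/q -map_drop drop_drop subnK 1?ltnW //.
  rewrite !tr_map_max Etr; have := lec _ (ltnW jm).
  have := tr_take_drop j a; have := tr_take_drop m a.
  by have := tr_take_drop j rho; have := tr_take_drop m rho; lra.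
- move=> t; have [tc|ct] := ltP t c.
    exists k => //; rewrite [take k rho]take_oversize ?size_rho //.
    rewrite [drop k rho]drop_oversize ?size_rho // take_size big_nil addr0 -tr_nu.
    rewrite -size_nu; have : all (fun x => t <= x) (z ++ q).
      rewrite all_cat; apply/andP; split.
        by apply: sub_all zc => x; apply: le_trans (ltW tc).
      by apply: sub_all qc => x; apply: le_trans (ltW tc).
    elim: (z ++ q) => [|x s IH] /=; rewrite ?big_nil ?tr_nil ?mul0r ?subr0 //.
    case/andP => tx /IH; rewrite big_cons tr_cons -natr1 mulrDl mul1r.
    by rewrite ge0_pos ?subr_ge0 //; lra.
  have [p pm le] := zpos t; rewrite !add0n in pm le; exists p.
    exact: leq_trans pm (ltnW mk).
  rewrite -Br big_cat /=; apply: lerD => //.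
  rewrite -[drop p rho](cat_take_drop (m - p)) drop_drop subnK // big_cat /=.
  rewrite ler_wpDl //; first by apply: sumr_ge0 => x _; apply: pos_ge0.
  rewrite /q big_map; apply: ler_sum => r _.
  case: (lerP c r) => cr; first by [].
  by rewrite le0_pos ?pos_ge0 // subr_le0.
Qed.

End Construction.

(** * Minimizers over the admissible increments *)

Section Minimization.
Context {R : realType}.
Implicit Types (x y rho a gamma : seq R) (f : R -> R) (t c : R) (i j p : nat).

Lemma size_addv x y : size x = size y -> size (addv x y) = size x.
Proof. by move=> E; rewrite size_map size_zip E minnn. Qed.

Lemma tr_addv x y : size x = size y -> tr (addv x y) = tr x + tr y.
Proof.
elim: x y => [|u x IH] [|v y] //= => [_|[/IH E]]; first by rewrite tr_nil addr0.
by rewrite /addv /= !tr_cons -/(addv x y) E; ring.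
Qed.

Lemma take_addv x y i : take i (addv x y) = addv (take i x) (take i y).
Proof.
elim: x y i => [|u x IH] [|v y] [|i] //=; rewrite /addv //= ?take0 //.
by congr cons; apply: IH.
Qed.

Lemma drop_addv x y i : size x = size y ->
  drop i (addv x y) = addv (drop i x) (drop i y).
Proof. by elim: x y i => [|u x IH] [|v y] [|i] //= [/IH]. Qed.

Lemma addv_cat x y x' y' : size x = size y ->
  addv (x ++ x') (y ++ y') = addv x y ++ addv x' y'.
Proof. by move=> E; rewrite /addv zip_cat // map_cat. Qed.

Lemma addv_subv x y : size x = size y -> addv x (subv y x) = y.
Proof.
elim: x y => [|u x IH] [|v y] //= [/IH E]; rewrite /addv /subv /= -[in RHS]E.
by congr cons; rewrite addrC subrK.
Qed.

Lemma addv0 x : addv x (nseq (size x) 0) = x.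
Proof. by elim: x => //= u x IH; rewrite /addv /= addr0 -[in RHS]IH. Qed.

Lemma addv_ge0 x y : all (fun t => 0 <= t) x -> all (fun t => 0 <= t) y ->
  all (fun t => 0 <= t) (addv x y).
Proof.
elim: x y => [|u x IH] [|v y] //= /andP[u0 x0] /andP[v0 y0].
by rewrite addr_ge0 //=; apply: IH.
Qed.

Definition midpoint x y : seq R := [seq (uv.1 + uv.2) / 2 | uv <- zip x y].

Lemma size_midpoint x y : size x = size y -> size (midpoint x y) = size x.
Proof. by move=> E; rewrite size_map size_zip E minnn. Qed.

Lemma nth_midpoint x y i : size x = size y -> (midpoint x y)`_i = (x`_i + y`_i) / 2.
Proof.
elim: x y i => [|u x IH] [|v y] // i; first by rewrite !nth_nil addr0 mul0r.
by case: i => [|i] //= [/IH].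
Qed.

Lemma tr_take_midpoint x y i : size x = size y ->
  tr (take i (midpoint x y)) = (tr (take i x) + tr (take i y)) / 2.
Proof.
move=> E; rewrite -!sum_nth_take -big_split /= mulr_suml.
by apply: eq_bigr => j _; rewrite nth_midpoint.
Qed.

Lemma sum_convex_midpoint f rho x y : strictly_convex f ->
  all (fun t => 0 <= t) rho -> all (fun t => 0 <= t) x ->
  all (fun t => 0 <= t) y -> size rho = size x -> size x = size y ->
  let lhs := \sum_(t <- addv rho (midpoint x y)) f t in
  let rhs := (\sum_(t <- addv rho x) f t + \sum_(t <- addv rho y) f t) / 2 in
  lhs <= rhs /\ (x != y -> lhs < rhs).
Proof.
move=> [_ fc]; elim: rho x y => [|r rho IH] [|u x] [|v y] //=.
  by move=> *; rewrite !big_nil addr0 mul0r; split.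
move=> /andP[r0 rho0] /andP[u0 x0] /andP[v0 y0] [srx] [sxy].
have /= [le lt] := IH x y rho0 x0 y0 srx sxy.
rewrite /addv /midpoint /= !big_cons -!/(addv _ _) -/(midpoint _ _) eqseq_cons.
move: le lt; set A := \sum_(t <- _) _; set X := \sum_(t <- _) _.
set Y := \sum_(t <- _) _ => le lt.
have [->|uv] := eqVneq u v.
  have -> : (v + v) / 2 = v by field.
  by split=> [|/lt]; lra.
have := fc (r + u) (r + v) 2^-1.
rewrite -subr_eq0 [X in X != 0](_ : _ = u - v); last by ring.
have -> : 2^-1 * (r + u) + (1 - 2^-1) * (r + v) = r + (u + v) / 2 by field.
rewrite subr_eq0 uv !addr_ge0 // => /(_ isT isT isT).
have -> : 0 < (2^-1 : R) < 1 by apply/andP; split; lra.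
by move=> /(_ isT) H; split=> [|_]; lra.
Qed.

Lemma GammaP a (e : nat) gamma : decreasing a -> all (fun t => 0 < t) a ->
  Gamma e a gamma <->
  [/\ size gamma = e, all (fun t => 0 <= t) gamma, decreasing gamma,
      (forall j, tr (take j a) <= tr (take j gamma)) & tr a = tr gamma].
Proof.
move=> ad ap; have a0 : all (fun t => 0 <= t) a by apply: sub_all ap => t /ltW.
split=> [[sg g0 gd /majorizedP[]]|[sg g0 gd le eqt]] //.
by split=> //; apply/majorizedP.
Qed.

Lemma Gamma_midpoint a (e : nat) x y : decreasing a -> all (fun t => 0 < t) a ->
  Gamma e a x -> Gamma e a y -> Gamma e a (midpoint x y).
Proof.
move=> ad ap /(GammaP _ _ _ ad ap)[sx x0 xd lex eqx].
move=> /(GammaP _ _ _ ad ap)[sy y0 yd ley eqy].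
have sxy : size x = size y by rewrite sx sy.
apply/(GammaP _ _ _ ad ap); split; first by rewrite size_midpoint.
- apply/(all_nthP 0) => i; rewrite size_midpoint // => ix.
  rewrite nth_midpoint // divr_ge0 // addr_ge0 //; first exact: (all_nthP 0 x0).
  by apply: (all_nthP 0 y0); rewrite -sxy.
- apply/(sortedP 0) => i; rewrite size_midpoint // => ix /=.
  rewrite !nth_midpoint // ler_pM2r ?invr_gt0 // lerD //.
    exact: nth_decreasing.
  by apply: nth_decreasing; rewrite // -sxy.
- by move=> j; rewrite tr_take_midpoint //; have := lex j; have := ley j; lra.
- rewrite -[in RHS](take_size (midpoint x y)) tr_take_midpoint // size_midpoint //.
  by rewrite take_size sxy take_size; lra.
Qed.

(** Two distinct minimizers would be beaten by their midpoint. *)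
Lemma mu_opt_unique f rho a gamma : strictly_convex f ->
  decreasing a -> all (fun t => 0 < t) a -> all (fun t => 0 <= t) rho ->
  minimizers f rho a gamma -> mu_opt f rho a = gamma.
Proof.
move=> fc ad ap rho0 [gG gmin]; apply: xget_unique => // x [xG xmin].
apply/eqP; apply: contraT => neq.
have [sg g0 _ _] := gG; have [sx x0 _ _] := xG.
have [_] := sum_convex_midpoint f rho x gamma fc rho0 x0 g0 (esym sx) (etrans sx (esym sg)).
move=> /(_ neq); have := gmin _ (Gamma_midpoint _ _ _ _ ad ap xG gG).
have := xmin _ gG; lra.
Qed.

Section Explicit.
Variables rho a : seq R.
Hypothesis rho_incr : sorted <=%R rho.
Hypothesis rho_ge0 : all (fun t => 0 <= t) rho.
Hypothesis a_decr : decreasing a.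
Hypothesis a_pos : all (fun t => 0 < t) a.
Hypothesis size_a : (size a <= size rho)%N.
Let k := size a.
Let rho' := take k rho.

Definition optimal_spectrum : seq R := Ncal rho' a ++ drop k rho.

(** The last [size rho - k] entries of an admissible increment vanish, because
    its first [k] entries already have the sum of [a]. *)
Definition optimal_increment : seq R :=
  subv (Ncal rho' a) rho' ++ nseq (size rho - k) 0.

Lemma size_rho' : size rho' = size a.
Proof. by rewrite size_takel. Qed.

Lemma Ncal_rho' :
  [/\ size (Ncal rho' a) = k,
      decreasing (subv (Ncal rho' a) rho') /\
        all (fun t => 0 <= t) (subv (Ncal rho' a) rho'),
      forall j, tr (take j a) + tr (take j rho') <= tr (take j (Ncal rho' a)),
      tr (Ncal rho' a) = tr rho' + tr a &
      forall t, exists2 p, (p <= k)%N &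
        \sum_(x <- Ncal rho' a) pos (x - t) <=
          tr (take p rho') + tr (take p a) - p%:R * t
          + \sum_(x <- drop p rho') pos (x - t)].
Proof. by apply: Ncal_spec; rewrite ?size_rho' // take_sorted. Qed.

Lemma size_optimal_increment : size optimal_increment = size rho.
Proof.
have [sN _ _ _ _] := Ncal_rho'.
by rewrite size_cat size_nseq size_subv ?sN ?size_rho' // subnKC.
Qed.

Lemma addv_optimal_increment : addv rho optimal_increment = optimal_spectrum.
Proof.
have [sN _ _ _ _] := Ncal_rho'.
rewrite -{1}(cat_take_drop k rho) addv_cat ?size_subv ?sN ?size_rho' //.
by rewrite addv_subv ?sN ?size_rho' // -size_drop addv0.
Qed.

Lemma size_optimal : size optimal_spectrum = size rho.
Proof. by rewrite -addv_optimal_increment size_addv ?size_optimal_increment. Qed.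

Lemma optimal_increment_Gamma : Gamma (size rho) a optimal_increment.
Proof.
have [sN [incd inc0] Nsum Ntr _] := Ncal_rho'.
have sNr : size (Ncal rho' a) = size rho' by rewrite sN size_rho'.
have tr_opt j : tr (take j optimal_increment) = tr (take j (subv (Ncal rho' a) rho')).
  rewrite take_cat; case: ltnP => [//|le].
  rewrite tr_cat [in RHS]take_oversize // [X in _ + X](_ : _ = 0) ?addr0 //.
  by rewrite /tr big1_seq // => t /andP[_ /mem_take]; rewrite mem_nseq => /andP[_ /eqP].
apply/GammaP => //; split.
- exact: size_optimal_increment.
- by rewrite all_cat inc0 all_nseq lexx orbT.
- have := decreasing_pad (size rho) _ incd inc0.
  by rewrite /pad size_subv // sN.
- move=> j; rewrite tr_opt take_subv tr_subv; last first.
    by rewrite [LHS]size_take_min sNr -size_take_min.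
  by have := Nsum j; lra.
- rewrite /optimal_increment tr_cat tr_subv // Ntr tr_nseq mulr0 addr0; ring.
Qed.

Lemma tr_optimal : tr optimal_spectrum = tr rho + tr a.
Proof.
have [_ _ _ Ntr _] := Ncal_rho'.
by rewrite tr_cat Ntr (tr_take_drop k rho); rewrite /rho'; ring.
Qed.

(** The index [p] obtained for the first [k] entries of [rho] serves for all of
    [rho]: the remaining entries contribute the same terms on both sides. *)
Lemma optimal_hinge y :
  (forall t p, (p <= k)%N ->
     tr (take p rho) + tr (take p a) - p%:R * t
       + \sum_(x <- drop p rho) pos (x - t) <= \sum_(x <- y) pos (x - t)) ->
  forall t, \sum_(x <- optimal_spectrum) pos (x - t) <= \sum_(x <- y) pos (x - t).
Proof.
move=> H t; have [_ _ _ _ /(_ t)[p pk le]] := Ncal_rho'.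
apply: le_trans (H t p pk); rewrite big_cat /=.
have -> : drop p rho = drop p rho' ++ drop k rho.
  rewrite -[in LHS](cat_take_drop k rho) drop_cat -/rho' size_rho'.
  case: ltnP => // kp; have -> : p = k by apply/eqP; rewrite eqn_leq pk.
  by rewrite subnn drop0 [drop k rho']drop_oversize ?size_rho'.
have E : take p rho' = take p rho by rewrite /rho' take_takel.
by rewrite [in leRHS]big_cat /= addrA -E lerD.
Qed.

Lemma optimal_hinge_Gamma gamma : Gamma (size rho) a gamma ->
  forall t, \sum_(x <- optimal_spectrum) pos (x - t) <=
            \sum_(x <- addv rho gamma) pos (x - t).
Proof.
move=> /(GammaP _ _ _ a_decr a_pos)[sg g0 gd le _].
apply: optimal_hinge => t p pk.
have pr : (p <= size rho)%N by apply: leq_trans size_a.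
rewrite -(cat_take_drop p (addv rho gamma)) big_cat /=; apply: lerD.
  apply: le_trans (sum_pos_ge _ _); rewrite take_addv tr_addv ?size_take_min ?sg //.
  rewrite size_addv ?size_take_min ?sg // (minn_idPl pr).
  by have := le p; lra.
rewrite drop_addv //.
have : all (fun t => 0 <= t) (drop p gamma).
  by apply/allP => x /mem_drop; apply: (allP g0).
have : size (drop p rho) = size (drop p gamma) by rewrite !size_drop sg.
elim: (drop p rho) (drop p gamma) => [|u x IH] [|v z] //=.
move=> [/IH sz] /andP[v0 /sz]; rewrite /addv /= !big_cons -/(addv _ _); apply: lerD.
by apply: pos_mono; rewrite lerB // lerDl.
Qed.

Lemma nu_opt_explicit f : strictly_convex f -> nu_opt f rho a = optimal_spectrum.
Proof.
move=> fc; rewrite /nu_opt -addv_optimal_increment; congr addv.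
apply: mu_opt_unique => //; split=> [|gamma gG]; first exact: optimal_increment_Gamma.
have [_ _ _ _ trg] := (GammaP _ _ _ a_decr a_pos).1 gG; have [sg g0 _ _] := gG.
rewrite addv_optimal_increment; apply: karamata => //.
- exact: addv_ge0.
- by rewrite size_optimal size_addv.
- apply: hinge_majorizes; last exact: optimal_hinge_Gamma.
    by rewrite size_optimal size_addv.
  by rewrite tr_optimal tr_addv // trg.
- by rewrite tr_optimal tr_addv // trg.
Qed.

End Explicit.
End Minimization.

(** * Hermitian matrices and frame operators *)

Section Spectra.
Local Open Scope complex_scope.
Local Open Scope ring_scope.
Local Open Scope sesquilinear_scope.
Context {R : realType} {d : nat}.
Local Notation C := R[i].
Implicit Types (x y : seq R) (g h : 'rV[C]_d) (F G : seq 'rV[C]_d) (H P : 'M[C]_d).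

Definition real_diag y : 'rV[C]_d := \row_j (y`_j)%:C.

Lemma ge0_real_part (z : C) : 0 <= z -> (complex.Re z)%:C = z.
Proof. by move=> z0; rewrite RRe_real // ger0_real. Qed.

Lemma rank_oneT g : rank_one g g = g ^t* *m g.
Proof. by []. Qed.

Lemma rank_one_entry g h a b : rank_one g h a b = (h 0 a)^* * g 0 b.
Proof. by rewrite /rank_one !mxE big_ord1 !mxE. Qed.

Lemma dotmx_sum g h : dotmx g h = \sum_j g 0 j * (h 0 j)^*.
Proof. by rewrite dotmxE mxE; apply: eq_bigr => j _; rewrite !mxE. Qed.

Lemma frame_op_cat F G : frame_op (F ++ G) = frame_op F + frame_op G.
Proof. exact: big_cat. Qed.

Lemma frame_op_hermitian F : frame_op F \is hermsymmx.
Proof.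
apply/is_hermitianmxP; rewrite expr0 scale1r; apply/matrixP => a b.
rewrite !mxE !summxE rmorph_sum; apply: eq_bigr => g _ /=.
by rewrite !rank_one_entry rmorphM /= conjCK mulrC.
Qed.

Lemma tr_rank_one g : \tr (rank_one g g) = dotmx g g.
Proof. by rewrite rank_oneT mxtrace_mulC dotmxE trace_mx11. Qed.

Lemma mxtrace_gram_ge0 m n (W : 'M[C]_(m, n)) : 0 <= \tr (W *m W ^t*).
Proof.
apply: sumr_ge0 => i _; rewrite mxE; apply: sumr_ge0 => j _.
by rewrite !mxE mul_conjC_ge0.
Qed.

Lemma spectral_entry P (x : 'rV[C]_d) a b :
  (P ^t* *m diag_mx x *m P) a b = \sum_i (P i a)^* * x 0 i * P i b.
Proof. by rewrite mul_mx_diag mxE; apply: eq_bigr => i _; rewrite !mxE. Qed.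

Lemma hermitian_spectral_real H : H \is hermsymmx ->
  H = (spectralmx H) ^t* *m diag_mx (spectral_diag H) *m spectralmx H /\
  forall j, spectral_diag H 0 j = (complex.Re (spectral_diag H 0 j))%:C.
Proof.
move=> Hh; have /orthomx_spectralP E := hermitian_normalmx Hh.
split; first by rewrite -invmx_unitary ?spectral_unitarymx.
move=> j; rewrite RRe_real //.
by have /mxOverP := hermitian_spectral_diag_real Hh; apply.
Qed.

Lemma size_eigenvalues H : size (eigenvalues H) = d.
Proof. by rewrite size_map size_enum_ord. Qed.

Lemma perm_eig_asc H : perm_eq (eig_asc H) (eigenvalues H).
Proof. by rewrite perm_sort. Qed.

Lemma size_eig_asc H : size (eig_asc H) = d.
Proof. by rewrite (perm_size (perm_eig_asc H)) size_eigenvalues. Qed.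

Lemma eig_asc_increasing H : sorted <=%R (eig_asc H).
Proof. by apply: sort_sorted => u v; apply: le_total. Qed.

(** Permuting the rows of [spectralmx H] sorts the eigenvalues. *)
Lemma sorted_spectral H : H \is hermsymmx ->
  exists2 P, P \is unitarymx & H = P ^t* *m diag_mx (real_diag (eig_asc H)) *m P.
Proof.
move=> Hh; have [E Ereal] := hermitian_spectral_real _ Hh.
set P0 := spectralmx H in E; have P0u : P0 \is unitarymx by apply: spectral_unitarymx.
pose lam j := complex.Re (spectral_diag H 0 j).
have : perm_eq (eig_asc H) [tuple lam j | j < d].
  exact: perm_eig_asc.
move=> /tuple_permP[p Ep].
have lamp (i : 'I_d) : (eig_asc H)`_i = lam (p i).
  rewrite Ep (nth_map i) ?size_enum_ord ?ltn_ord // nth_ord_enum.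
  by rewrite !tnth_mktuple.
exists (row_perm p P0).
  have rowp i : row i (row_perm p P0) = row (p i) P0.
    by apply/rowP => b; rewrite !mxE.
  apply/row_unitarymxP => i j; rewrite !rowp.
  by have /row_unitarymxP/(_ (p i) (p j)) -> := P0u; rewrite (inj_eq perm_inj).
apply/matrixP => a b; rewrite [in LHS]E !spectral_entry (reindex_inj (@perm_inj _ p)).
by apply: eq_bigr => i _; rewrite !mxE lamp Ereal.
Qed.

Lemma char_poly_conjugate P H : P \in unitmx ->
  char_poly (invmx P *m H *m P) = char_poly H.
Proof.
move=> Pu; rewrite /char_poly /char_poly_mx.
set Mi := map_mx polyC (invmx P); set Mp := map_mx polyC P.
have Ep : Mi *m Mp = 1%:M by rewrite -map_mxM mulVmx // map_mx1.
have -> : map_mx polyC (invmx P *m H *m P) = Mi *m map_mx polyC H *m Mp.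
  by rewrite !map_mxM.
have -> : 'X%:M - Mi *m map_mx polyC H *m Mp =
    Mi *m ('X%:M - map_mx polyC H) *m Mp.
  by rewrite mulmxBr mulmxBl scalar_mxC -(mulmxA _ Mi Mp) Ep mulmx1.
by rewrite !det_mulmx mulrAC -det_mulmx Ep det1 mul1r.
Qed.

Lemma char_poly_diag (x : 'rV[C]_d) :
  char_poly (diag_mx x) = \prod_(c <- [seq x 0 j | j <- enum 'I_d]) ('X - c%:P).
Proof.
rewrite char_poly_trig; last exact/is_diag_mx_is_trig/diag_mx_is_diag.
rewrite big_map big_enum; apply: eq_bigr => j _.
by rewrite !mxE eqxx mulr1n.
Qed.

(** The characteristic polynomial determines the eigenvalues up to order. *)
Lemma perm_eigenvalues P H y : P \is unitarymx -> size y = d ->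
  H = P ^t* *m diag_mx (real_diag y) *m P -> perm_eq (eigenvalues H) y.
Proof.
move=> Pu sy; rewrite -invmx_unitary // => E.
have /orthomx_spectralP E0 : H \is normalmx.
  by apply/orthomx_spectral_subproof; exists (P, real_diag y).
have : char_poly (diag_mx (spectral_diag H)) = char_poly (diag_mx (real_diag y)).
  transitivity (char_poly H).
    by rewrite [in RHS]E0 char_poly_conjugate // spectral_unit.
  by rewrite [in LHS]E char_poly_conjugate // unitarymx_unit.
rewrite !char_poly_diag => /prod_XsubC_eq/(perm_map (@complex.Re R)).
have mapRe (x : 'rV[C]_d) : [seq complex.Re c | c <- [seq x 0 j | j <- enum 'I_d]] =
    [seq complex.Re (x 0 j) | j <- enum 'I_d].
  by elim: (enum _) => //= i s ->.
rewrite !mapRe => Eperm; apply: perm_trans Eperm _.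
rewrite (eq_map (_ : _ =1 (nth 0 y \o val))); last by move=> j /=; rewrite mxE.
by rewrite map_comp val_enum_ord -sy -/(mkseq _ _) mkseq_nth.
Qed.

Lemma tr_eigenvalues H : H \is hermsymmx -> (tr (eigenvalues H))%:C = \tr H.
Proof.
move=> /hermitian_spectral_real[E Ereal].
rewrite [in RHS]E -mulmxA mxtrace_mulC -mulmxA (unitarymxP (spectral_unitarymx H)) //.
rewrite mulmx1 mxtrace_diag /tr big_map big_enum /= rmorph_sum.
by apply: eq_bigr => j _; rewrite [RHS]Ereal.
Qed.

Lemma eig_asc_ge0 F : all (fun t => 0 <= t) (eig_asc (frame_op F)).
Proof.
have [P Pu E] := sorted_spectral _ (frame_op_hermitian F).
apply/(all_nthP 0) => i; rewrite size_eig_asc => id.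
pose i' := Ordinal id; rewrite -ler0c.
have -> : ((eig_asc (frame_op F))`_i)%:C =
    (P *m frame_op F *m P ^t*) i' i'.
  rewrite [in RHS]E !mulmxA (unitarymxP Pu) mul1mx -mulmxA (unitarymxP Pu).
  by rewrite mulmx1 !mxE eqxx.
rewrite /frame_op mulmx_sumr mulmx_suml summxE; apply: sumr_ge0 => g _.
rewrite rank_oneT mulmxA -mulmxA; have -> : g *m P ^t* = (P *m g ^t*) ^t*.
  by rewrite trmx_mul map_mxM /= trmxCK.
by rewrite mxE big_ord1 !mxE mul_conjC_ge0.
Qed.

(** The rows of [V] being orthonormal, [V^t* *m V] is the orthogonal projection
    on their span; [w j] is its diagonal entry at the [j]-th row of [P], the
    squared norm of the projection of a unit vector.  Traces of compressions to
    the span are thus weighted sums of eigenvalues. *)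
Lemma proj_weights r (V : 'M[C]_(r, d)) P : V \is unitarymx -> P \is unitarymx ->
  exists w : 'I_d -> R,
  [/\ forall j, 0 <= w j <= 1,
      forall j, (row j P <= V)%MS -> w j = 1,
      \sum_j w j = r%:R &
      forall y, \tr (V *m (P ^t* *m diag_mx (real_diag y) *m P) *m V ^t*) =
        (\sum_(j < d) y`_j * w j)%:C].
Proof.
move=> /unitarymxP Vu /unitarymxP Pu; pose W := V *m P ^t*.
pose Q := W ^t* *m W.
have Wu : W *m W ^t* = 1%:M.
  rewrite /W trmx_mul map_mxM /= trmxCK -mulmxA (mulmxA (P ^t*)).
  have -> : P ^t* *m P = 1%:M by apply: mulmx1C.
  by rewrite mul1mx.
have Qh : Q ^t* = Q by rewrite /Q trmx_mul map_mxM /= trmxCK.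
have QQ : Q *m Q = Q by rewrite /Q mulmxA -(mulmxA _ W) Wu mulmx1.
have Qd j : Q j j = \sum_l `|Q j l| ^+ 2.
  rewrite -{1}QQ mxE; apply: eq_bigr => l _; rewrite normCK; congr (_ * _).
  by rewrite -[in LHS]Qh !mxE.
have Q0 j : 0 <= Q j j by rewrite Qd; apply: sumr_ge0 => l _; rewrite exprn_ge0.
have Qw j : (complex.Re (Q j j))%:C = Q j j by apply: ge0_real_part.
exists (fun j => complex.Re (Q j j)); split.
- move=> j; rewrite -ler0c -lecR Qw Q0 /=.
  (* a diagonal entry of a projection is the squared norm of its row *)
  have : Q j j ^+ 2 <= Q j j.
    rewrite [leRHS]Qd (bigD1 j) //= ger0_norm // lerDl.
    by apply: sumr_ge0 => l _; rewrite exprn_ge0.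
  have := Q0 j; rewrite le_eqVlt => /orP[/eqP<- _|Qpos]; first exact: ler01.
  by rewrite expr2 -{3}[Q j j]mulr1 ler_pM2l.
- move=> j /submxP[c Ec]; apply: (@complexI R); rewrite Qw.
  have -> : Q j j = row j Q 0 j by rewrite [RHS]mxE.
  have -> : Q = P *m (V ^t* *m V *m P ^t*).
    by rewrite /Q /W trmx_mul map_mxM /= trmxCK !mulmxA.
  rewrite row_mul Ec -(mulmxA c) !mulmxA -(mulmxA c) Vu mulmx1 -Ec -row_mul Pu.
  by rewrite !mxE eqxx.
- apply: (@complexI R); rewrite rmorph_sum /=; under eq_bigr do rewrite Qw.
  have -> : \sum_j Q j j = \tr Q by [].
  by rewrite /Q mxtrace_mulC Wu mxtrace1 rmorph_nat.
- move=> y; have -> : V *m (P ^t* *m diag_mx (real_diag y) *m P) *m V ^t* =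
      W *m (diag_mx (real_diag y) *m W ^t*).
    by rewrite /W trmx_mul map_mxM /= trmxCK !mulmxA.
  rewrite mxtrace_mulC -mulmxA -/Q rmorph_sum; apply: eq_bigr => j _ /=.
  by rewrite mul_diag_mx mxE [real_diag _ _ _]mxE rmorphM /= Qw.
Qed.

Lemma tr_compress_rank_one r (V : 'M[C]_(r, d)) g :
  0 <= \tr (V *m rank_one g g *m V ^t*).
Proof.
have -> : V *m rank_one g g *m V ^t* = (V *m g ^t*) *m (V *m g ^t*) ^t*.
  by rewrite rank_oneT trmx_mul map_mxM /= trmxCK !mulmxA.
exact: mxtrace_gram_ge0.
Qed.

Lemma tr_compress_rank_one_sub r (V : 'M[C]_(r, d)) g :
  V \is unitarymx -> (g <= V)%MS -> \tr (V *m rank_one g g *m V ^t*) = dotmx g g.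
Proof.
move=> /unitarymxP Vu /submxP[c Ec].
rewrite rank_oneT !mulmxA mxtrace_mulC !mulmxA.
have -> : V ^t* *m V *m g ^t* = g ^t*.
  by rewrite Ec trmx_mul map_mxM /= -!mulmxA (mulmxA V) Vu mul1mx.
by rewrite mxtrace_mulC dotmxE trace_mx11.
Qed.

End Spectra.

(** * Spectra of completions *)

Section SpectralLowerBound.
Local Open Scope complex_scope.
Local Open Scope ring_scope.
Local Open Scope sesquilinear_scope.
Context {R : realType} {d : nat}.
Local Notation C := R[i].
Implicit Types (x y a rho : seq R) (g h : 'rV[C]_d) (F G : seq 'rV[C]_d).

Lemma sum_sub_const x (t : R) : \sum_(u <- x) (u - t) = tr x - (size x)%:R * t.
Proof.
elim: x => [|u x IH]; first by rewrite big_nil tr_nil mul0r subrr.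
by rewrite big_cons IH tr_cons /= -natr1; ring.
Qed.

Lemma sum_seq_ord x (f : R -> R) : size x = d ->
  \sum_(u <- x) f u = \sum_(j < d) f x`_j.
Proof. by move=> <-; rewrite (big_nth 0) big_mkord. Qed.

(** Among weights in [0, 1] that equal 1 above [t] and have a total mass of at
    most [p] below [t], the sum of the [(rho_j - t) * w j] is least when the
    mass [p] sits on the [p] smallest entries. *)
Lemma weighted_hinge rho (w : 'I_d -> R) (t : R) (p : nat) :
  size rho = d -> sorted <=%R rho -> (p <= d)%N ->
  (forall j, 0 <= w j <= 1) -> (forall j : 'I_d, t < rho`_j -> w j = 1) ->
  \sum_j w j <= #|[pred j : 'I_d | t < rho`_j]|%:R + p%:R ->
  tr (take p rho) - p%:R * t + \sum_(x <- drop p rho) pos (x - t) <=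
    \sum_(j < d) (rho`_j - t) * w j.
Proof.
move=> srho incr pd w01 w1 wsum.
(* s separates the p smallest entries, truncated at t, from the other ones;
   s - t is the multiplier of the constraint on the mass *)
pose s := if (p < d)%N then Num.min rho`_p t else t.
have st : s <= t by rewrite /s; case: ifP => // _; rewrite ge_min lexx orbT.
pose low (x : R) := pos (s - Num.min x t).
have step (j : 'I_d) : pos (rho`_j - t) - low rho`_j +
    (s - t) * (w j - (t < rho`_j)%R%:R) <= (rho`_j - t) * w j.
  rewrite /low; have /andP[w0 w1j] := w01 j; case: (ltP t rho`_j) => [tlt|lt].
    have -> : pos (rho`_j - t) = rho`_j - t by rewrite ge0_pos // subr_ge0 ltW.
    have -> : pos (s - t) = 0 by rewrite le0_pos // subr_le0.
    by rewrite (w1 _ tlt) /=; lra.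
  have -> : pos (rho`_j - t) = 0 by rewrite le0_pos // subr_le0.
  rewrite /= subr0 sub0r.
  have [le|le] := lerP s rho`_j; first by rewrite le0_pos ?subr_le0 //; nra.
  by rewrite ge0_pos ?subr_ge0 ?(ltW le) //; nra.
apply: le_trans (ler_sum _ (fun j _ => step j)).
rewrite big_split /= -mulr_sumr [X in _ + _ * X]sumrB -natr_sum.
have -> : (\sum_(j < d) (t < rho`_j)%R)%N = #|[pred j : 'I_d | t < rho`_j]|.
  by rewrite -sum1_card [RHS]big_mkcond; apply: eq_bigr => j _; rewrite inE; case: ifP.
rewrite -(sum_seq_ord _ (fun u => pos (u - t) - low u) srho).
set n := #|_|%:R in wsum *.
have : (s - t) * p%:R <= (s - t) * (\sum_j w j - n) by nra.
suff : tr (take p rho) - p%:R * t + \sum_(x <- drop p rho) pos (x - t) <=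
    \sum_(x <- rho) (pos (x - t) - low x) + (s - t) * p%:R by lra.
rewrite -{3}(cat_take_drop p rho) big_cat /=.
have spr : size (take p rho) = p by rewrite size_takel // srho.
rewrite -{1}[p in p%:R * t]spr -sum_sub_const addrAC lerD //.
  have -> : (s - t) * p%:R = \sum_(x <- take p rho) (s - t).
    by rewrite big_const_seq count_predT spr iter_addr_0 mulr_natr.
  rewrite -big_split /= big_seq [leRHS]big_seq; apply: ler_sum => x.
  case/(nthP 0) => i; rewrite spr => ip <-; rewrite nth_take // /low.
  have les : Num.min rho`_i t <= s.
    rewrite /s; case: ifP => pd'; last by rewrite ge_min lexx orbT.
    have : rho`_i <= rho`_p by apply: nth_increasing; rewrite ?srho // ltnW.
    by move=> le; rewrite le_min !ge_min le lexx orbT.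
  rewrite (ge0_pos (s - _)) ?subr_ge0 //.
  case: (lerP rho`_i t) => le; first by have := pos_ge0 (rho`_i - t); lra.
  by have := le_pos (rho`_i - t); lra.
rewrite big_seq [leRHS]big_seq; apply: ler_sum => x.
case/(nthP 0) => i; rewrite size_drop srho => id <-; rewrite nth_drop /low.
have pid : (p + i < d)%N by rewrite -ltn_subRL.
rewrite (le0_pos (s - _)) ?subr0 // subr_le0 /s (leq_ltn_trans _ pid) ?leq_addr //.
rewrite le_min !ge_min lexx orbT andbT.
by rewrite nth_increasing ?leq_addr ?srho.
Qed.

Lemma rank_sum_le (I : finType) (S : pred I) m (B : I -> 'M[C]_(m, d)) :
  (m <= 1)%N -> (\rank (\sum_(i | S i) <<B i>>)%MS <= #|S|)%N.
Proof.
move=> m1; rewrite -sum1_card.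
elim/big_rec2: _ => [|i n M _ le]; first by rewrite mxrank0.
apply: leq_trans (mxrank_adds_leqif _ _) _; rewrite leq_add //.
by rewrite mxrank_gen (leq_trans (rank_leq_row _)).
Qed.

(** Compress to the span of the eigenvectors of [frame_op F0] above [t] and of
    the first [p] vectors of [G].  The compressed [frame_op G] has trace at least
    [a_1 + ... + a_p]; the weights of [frame_op F0] equal 1 above [t] and have
    mass at most [p] below, since the span has dimension at most [p] more; and
    the weights of the whole operator lie in [0, 1], which bounds its trace by
    the hinge sum. *)
Lemma eigenvalues_hinge F0 G a (t : R) (p : nat) :
  [seq dotmx g g | g <- G] = [seq u%:C | u <- a] -> (p <= d)%N ->
  tr (take p (eig_asc (frame_op F0))) + tr (take p a) - p%:R * t
    + \sum_(x <- drop p (eig_asc (frame_op F0))) pos (x - t) <=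
  \sum_(x <- eigenvalues (frame_op (F0 ++ G))) pos (x - t).
Proof.
move=> normG pd; set rho := eig_asc (frame_op F0); set H := frame_op (F0 ++ G).
have [P Pu EA] := sorted_spectral _ (frame_op_hermitian F0).
have [Q Qu EH] := sorted_spectral _ (frame_op_hermitian (F0 ++ G)).
rewrite -/rho in EA; rewrite -/H in EH.
rewrite -(perm_big _ (perm_eig_asc H)) /=; set y := eig_asc H in EH *.
pose hi := [pred j : 'I_d | t < rho`_j].
pose U := (\sum_(j | hi j) <<row j P>> + \sum_(i < p) <<G`_i>>)%MS.
have rankU : (\rank U <= #|hi| + p)%N.
  apply: leq_trans (mxrank_adds_leqif _ _) _; apply: leq_add; first exact: rank_sum_le.
  by apply: leq_trans (rank_sum_le _ _ _ _ _) _ => //; rewrite card_ord.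
pose V := schmidt (row_base U).
have Vu : V \is unitarymx by apply/schmidt_unitarymx/rank_leq_col.
have VU : (U <= V)%MS.
  by rewrite /V (eqmx_schmidt_free (row_base_free U)) eq_row_base.
have [w [w01 w1 wsum wtr]] := proj_weights _ _ _ Vu Pu.
have [v [v01 _ vsum vtr]] := proj_weights _ _ _ Vu Qu.
have tr_compress : \tr (V *m frame_op G *m V ^t*) =
    \sum_(g <- G) \tr (V *m rank_one g g *m V ^t*).
  by rewrite /frame_op mulmx_sumr mulmx_suml raddf_sum.
have main : \sum_(j < d) rho`_j * w j + tr (take p a) <= \sum_(j < d) y`_j * v j.
  rewrite -lecR rmorphD /= -wtr -vtr -EA -EH /H frame_op_cat mulmxDr mulmxDl mxtraceD.
  rewrite lerD2l tr_compress -{1}(cat_take_drop p G) big_cat /=.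
  rewrite ler_wpDr //; first by apply: sumr_ge0 => g _; apply: tr_compress_rank_one.
  have -> : (tr (take p a))%:C = \sum_(g <- take p G) dotmx g g.
    by rewrite /tr rmorph_sum -(big_map _ predT id) map_take -normG -map_take big_map.
  rewrite big_seq [leRHS]big_seq; apply: ler_sum => g gp.
  rewrite tr_compress_rank_one_sub //; apply: submx_trans VU.
  case/(nthP 0): gp => i; rewrite size_take_min leq_min => /andP[ip _] <-.
  rewrite nth_take //; apply: submx_trans (addsmxSr _ _).
  by apply: (sumsmx_sup (Ordinal ip)) => //=; rewrite genmxE.
have w_hi (j : 'I_d) : t < rho`_j -> w j = 1.
  move=> tj; apply: w1; apply: submx_trans VU; apply: submx_trans (addsmxSl _ _).
  by apply: (sumsmx_sup j) => //; rewrite genmxE.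
have wle : \sum_j w j <= #|hi|%:R + p%:R by rewrite wsum -natrD ler_nat.
have := weighted_hinge rho w t p (size_eig_asc _) (eig_asc_increasing _) pd w01 w_hi wle.
have sumt z (u : 'I_d -> R) :
    \sum_(j < d) (z j - t) * u j = \sum_(j < d) z j * u j - t * \sum_j u j.
  by rewrite mulr_sumr -sumrB; apply: eq_bigr => j _; rewrite mulrBl.
have : \sum_(j < d) (y`_j - t) * v j <= \sum_(x <- y) pos (x - t).
  rewrite (sum_seq_ord _ _ (size_eig_asc H)); apply: ler_sum => j _.
  have /andP[v0 v1] := v01 j; have := le_pos (y`_j - t); have := pos_ge0 (y`_j - t).
  by rewrite -/y; nra.
rewrite (sumt (fun j => y`_j)) (sumt (fun j => rho`_j)) wsum vsum; lra.
Qed.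

End SpectralLowerBound.

(** * The Schur-Horn theorem for frames *)

Section SchurHorn.
Local Open Scope complex_scope.
Local Open Scope ring_scope.
Local Open Scope sesquilinear_scope.
Context {R : realType} {d : nat}.
Local Notation C := R[i].
Implicit Types (x y : seq R) (g h : 'rV[C]_d) (G : seq 'rV[C]_d) (u v w : R).

Lemma conj_real (c : R) : (c%:C)^*%R = c%:C.
Proof. by apply/conj_Creal/complex_realP; exists c. Qed.

Lemma dotmx_combination (b c : C) g h :
  dotmx (b *: g + c *: h) (b *: g + c *: h) =
  b * b^*%R * dotmx g g + b * c^*%R * dotmx g h
  + c * b^*%R * dotmx h g + c * c^*%R * dotmx h h.
Proof.
rewrite !dotmx_sum !mulr_sumr -!big_split /=; apply: eq_bigr => j _.
by rewrite !mxE rmorphD !rmorphM /=; ring.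
Qed.

Lemma rank_one_combination (b c : C) g h :
  rank_one (b *: g + c *: h) (b *: g + c *: h) =
  (b^*%R * b) *: rank_one g g + (b^*%R * c) *: rank_one h g
  + ((c^*%R * b) *: rank_one g h + (c^*%R * c) *: rank_one h h).
Proof.
rewrite /rank_one; have -> : map_mx Num.conj (b *: g + c *: h)^T =
    b^*%R *: map_mx Num.conj g^T + c^*%R *: map_mx Num.conj h^T.
  by apply/matrixP => i j; rewrite !mxE rmorphD !rmorphM.
by rewrite mulmxDl !mulmxDr -!scalemxAl -!scalemxAr !scalerA.
Qed.

Lemma dotmxC g h : dotmx h g = (dotmx g h)^*%R.
Proof.
rewrite !dotmx_sum rmorph_sum; apply: eq_bigr => j _ /=.
by rewrite rmorphM /= conjCK mulrC.
Qed.

(** A suitable phase makes the inner product of [g] and [c *: h] purely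
    imaginary, so that a real rotation of the pair mixes their squared norms
    without cross term. *)
Lemma orthogonalizing_phase g h : exists2 c : C, c * c^*%R = 1 &
  c^*%R * dotmx g h + c * dotmx h g = 0.
Proof.
rewrite (dotmxC g h); set z := dotmx g h.
have [->|z0] := eqVneq z 0; first by exists 1; rewrite rmorph1 ?rmorph0 ?mulr0 ?addr0 ?mulr1.
have n0 : `|z| != 0 by rewrite normr_eq0.
have zz : z * z^*%R = `|z| ^+ 2 by rewrite normCK.
have ii : 'i%R * 'i%R = -1 :> C by rewrite -expr2 sqrCi.
exists ('i%R * z / `|z|).
  rewrite !rmorphM /= fmorphV /= conjCi (conj_Creal (normr_real _)).
  have -> : 'i%R * z / `|z| * (- 'i%R * z^*%R / `|z|) =
      - ('i%R * 'i%R) * (z * z^*%R) / (`|z| * `|z|) by field.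
  by rewrite ii zz opprK mul1r -expr2 divff // expf_neq0.
rewrite !rmorphM /= fmorphV /= conjCi (conj_Creal (normr_real _)).
by field.
Qed.

Lemma rank_one_phase (c : C) g : c * c^*%R = 1 ->
  rank_one (c *: g) (c *: g) = rank_one g g.
Proof.
move=> cc; apply/matrixP => i j; rewrite !rank_one_entry !mxE rmorphM /=.
by transitivity (c * c^*%R * ((g 0 i)^*%R * g 0 j)); [ring|rewrite cc mul1r].
Qed.

(** A rotation in the plane of indices of [g] and of a phase multiple of [h]
    preserves the sum of the rank-one operators, and moves the squared norms to
    any value between them. *)
Lemma rotate_pair g h u v w : dotmx g g = u%:C -> dotmx h h = v%:C ->
  v <= w <= u -> exists g' h', [/\ dotmx g' g' = w%:C,
    dotmx h' h' = (u + v - w)%:C &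
    rank_one g' g' + rank_one h' h' = rank_one g g + rank_one h h].
Proof.
move=> gu hv /andP[vw wu].
have [uv|uv] := eqVneq u v.
  have -> : w = u by lra.
  by exists g, h; split=> //; rewrite hv addrAC subrr add0r.
have uv0 : 0 < u - v by rewrite lt_neqAle eq_sym subr_eq0 uv subr_ge0; lra.
have [e ee eorth] := orthogonalizing_phase g h.
(* squared cosine and sine, such that c^2 u + s^2 v = w *)
pose c := Num.sqrt ((w - v) / (u - v)); pose s := Num.sqrt ((u - w) / (u - v)).
have cE : c * c = (w - v) / (u - v).
  by rewrite -expr2 sqr_sqrtr // divr_ge0 // ?(ltW uv0) // subr_ge0.
have sE : s * s = (u - w) / (u - v).
  by rewrite -expr2 sqr_sqrtr // divr_ge0 // ?(ltW uv0) // subr_ge0.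
have uvn : u - v != 0 by rewrite gt_eqF.
have cs1 : c * c + s * s = 1 by rewrite cE sE; field.
pose h1 := e *: h.
have h1E : dotmx h1 h1 = v%:C.
  rewrite -hv !dotmx_sum; apply: eq_bigr => j _; rewrite !mxE rmorphM /=.
  by transitivity (e * e^*%R * (h 0 j * (h 0 j)^*%R)); [ring|rewrite ee mul1r].
have orth : dotmx g h1 + dotmx h1 g = 0.
  rewrite -[RHS]eorth; congr (_ + _); rewrite !dotmx_sum mulr_sumr;
    apply: eq_bigr => j _; rewrite !mxE ?rmorphM /=; ring.
exists (c%:C *: g + s%:C *: h1), ((- s)%:C *: g + c%:C *: h1); split.
- rewrite dotmx_combination !conj_real gu h1E.
  transitivity (c%:C * c%:C * u%:C + s%:C * s%:C * v%:C
      + c%:C * s%:C * (dotmx g h1 + dotmx h1 g)).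
    by move: (dotmx g h1) (dotmx h1 g) (c%:C) (s%:C) => *; ring.
  rewrite orth mulr0 addr0 -!rmorphM -rmorphD cE sE /=.
  by congr (_%:C); field.
- rewrite dotmx_combination !conj_real gu h1E.
  transitivity ((-s)%:C * (-s)%:C * u%:C + c%:C * c%:C * v%:C
      + c%:C * (-s)%:C * (dotmx g h1 + dotmx h1 g)).
    by move: (dotmx g h1) (dotmx h1 g) (c%:C) ((- s)%:C) => *; ring.
  rewrite orth mulr0 addr0 -!rmorphM -rmorphD mulrNN cE sE /=.
  by congr (_%:C); field.
- rewrite -(rank_one_phase e h ee) -/h1 !rank_one_combination !conj_real.
  have {}cs1 : c%:C * c%:C + s%:C * s%:C = 1.
    by rewrite -!rmorphM -rmorphD cs1 rmorph1.
  rewrite rmorphN /=; move: (c%:C) (s%:C) cs1 => c' s' cs1.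
  set A := rank_one g g; set B := rank_one g h1; set D := rank_one h1 g.
  set E := rank_one h1 h1; move: A B D E => A B D E.
  have -> : A + E = (c' * c' + s' * s') *: (A + E) by rewrite cs1 scale1r.
  by apply/matrixP => i j; rewrite !mxE; ring.
Qed.

(** Each transfer of squared norms is a rotation, so every vector of squared
    norms majorized by that of [G] is realized with the same frame operator. *)
Lemma schur_horn x y G : size x = size y -> decreasing x -> decreasing y ->
  (forall j, tr (take j x) <= tr (take j y)) -> tr x = tr y ->
  [seq dotmx g g | g <- G] = [seq t%:C | t <- y] ->
  exists2 G', [seq dotmx g g | g <- G'] = [seq t%:C | t <- x] &
              frame_op G' = frame_op G.
Proof.
move=> sxy xd yd le eqt normG.
pose Q z := exists2 G', [seq dotmx g g | g <- G'] = [seq t%:C | t <- z] &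
                        frame_op G' = frame_op G.
apply: (transfer_ind Q) sxy xd yd le eqt _; last by exists G.
- move=> s z sz [G1 norm1 op1]; have := sz; rewrite perm_sym.
  case/(perm_iotaP 0) => Is pIs Ez.
  have size1 : size G1 = size s by rewrite -(size_map (fun g => dotmx g g)) norm1 size_map.
  exists [seq G1`_i | i <- Is].
    rewrite Ez -!map_comp; apply/eq_in_map => i iIs /=.
    have is1 : (i < size s)%N.
      by move: iIs; rewrite (perm_mem pIs) mem_iota.
    have := congr1 (fun l => l`_i) norm1.
    by rewrite (nth_map 0) ?size1 // (nth_map 0).
  rewrite -op1; apply: perm_big; apply/(perm_iotaP 0).
  by exists Is; rewrite ?size1.
- move=> u v w s vwu [[|g [|h G1]] //= [gu hv norm1] op1].
  have [g' [h' [g'w h'w opgh]]] := rotate_pair _ _ _ _ _ gu hv vwu.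
  exists [:: g', h' & G1]; first by rewrite /= g'w h'w norm1.
  by rewrite -op1 /frame_op !big_cons !addrA opgh.
Qed.

End SchurHorn.

(** * Optimal completions *)

Section Completion.
Local Open Scope complex_scope.
Local Open Scope ring_scope.
Local Open Scope sesquilinear_scope.
Context {R : realType} {d : nat}.
Variables (F0 : seq 'rV[R[i]]_d) (a : seq R).
Hypothesis a_decr : decreasing a.
Hypothesis a_pos : all (fun t => 0 < t) a.
Hypothesis size_a : (size a <= d)%N.
Let k := size a.
Let rho := eig_asc (frame_op F0).
Let mu := optimal_increment rho a.

Let rho_incr : sorted <=%R rho := eig_asc_increasing _.
Let size_rho : size rho = d := size_eig_asc _.
Let size_a_rho : (size a <= size rho)%N.
Proof. by rewrite size_rho. Qed.

Lemma optimal_increment_admissible : Gamma d a mu.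
Proof.
have := @optimal_increment_Gamma _ rho a rho_incr a_decr a_pos size_a_rho.
by rewrite size_rho.
Qed.

Lemma Gamma_drop (e : nat) gamma : Gamma e a gamma ->
  tr (take k gamma) = tr a /\ all (fun t => t == 0) (drop k gamma).
Proof.
move=> /(GammaP _ _ _ a_decr a_pos)[sg g0 gd le eqt].
have := le k; rewrite take_size.
have d0 : all (fun t => 0 <= t) (drop k gamma).
  by apply/allP => t /mem_drop; apply: (allP g0).
have td0 : 0 <= tr (drop k gamma).
  by rewrite /tr big_seq; apply: sumr_ge0 => t; apply: (allP d0).
move: eqt; rewrite (tr_take_drop k gamma) => eqt lek.
have : tr (drop k gamma) = 0 by lra.
split; first by lra.
move: d0 H; elim: (drop k gamma) => //= u x IH /andP[u0 x0]; rewrite tr_cons.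
have : 0 <= tr x by rewrite /tr big_seq; apply: sumr_ge0 => t; apply: (allP x0).
move=> tx0 E; have -> : u = 0 by lra.
by rewrite eqxx IH //; lra.
Qed.

(** The vectors [sqrt gamma_i *: e_i], for an orthonormal basis [e], have the
    right frame operator and squared norms [gamma_i]; only the first [k] are
    nonzero, and the Schur-Horn theorem turns their squared norms into [a]. *)
Lemma frame_with_spectrum gamma (P : 'M[R[i]]_d) :
  Gamma d a gamma -> P \is unitarymx ->
  exists2 G, [seq dotmx g g | g <- G] = [seq t%:C | t <- a] &
             frame_op G = P ^t* *m diag_mx (real_diag gamma) *m P.
Proof.
move=> gG Pu; have [trk dropk] := Gamma_drop _ _ gG.
have [sg g0 gd le eqt] := (GammaP _ _ _ a_decr a_pos).1 gG.
pose v (i : 'I_d) := (Num.sqrt gamma`_i)%:C *: row i P.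
pose Gd := [seq v i | i <- enum 'I_d].
have gi0 (i : 'I_d) : 0 <= gamma`_i by apply: (all_nthP 0 g0); rewrite sg.
have rank_v (i : 'I_d) : rank_one (v i) (v i) =
    (gamma`_i)%:C *: rank_one (row i P) (row i P).
  apply/matrixP => b c; rewrite [RHS]mxE !rank_one_entry !mxE rmorphM /= conj_real.
  by rewrite -[in RHS](sqr_sqrtr (gi0 i)) expr2 rmorphM /=; ring.
have norm_v (i : 'I_d) : dotmx (v i) (v i) = (gamma`_i)%:C.
  rewrite -tr_rank_one rank_v linearZ /= tr_rank_one.
  by have /row_unitarymxP/(_ i i) -> := Pu; rewrite eqxx mulr1.
have normGd : [seq dotmx g g | g <- Gd] = [seq t%:C | t <- gamma].
  rewrite /Gd -map_comp (eq_map (_ : _ =1 (fun n : nat => (gamma`_n)%:C) \o val)).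
    by rewrite map_comp val_enum_ord -sg -[in RHS](mkseq_nth 0 gamma) -map_comp.
  by move=> i /=; rewrite norm_v.
have opGd : frame_op Gd = P ^t* *m diag_mx (real_diag gamma) *m P.
  rewrite /frame_op big_map big_enum /=; apply/matrixP => b c.
  rewrite summxE spectral_entry; apply: eq_bigr => i _.
  by rewrite rank_v mxE rank_one_entry !mxE; ring.
have opk : frame_op (take k Gd) = frame_op Gd.
  rewrite -[in RHS](cat_take_drop k Gd) frame_op_cat.
  rewrite [X in _ = _ + X]/frame_op big1_seq ?addr0 // => g /andP[_].
  case/(nthP 0) => j; rewrite size_drop size_map size_enum_ord => jd <-.
  have kjd : (k + j < d)%N by rewrite -ltn_subRL.
  rewrite nth_drop (nth_map (Ordinal kjd)) ?size_enum_ord // rank_v.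
  have -> : nth (Ordinal kjd) (enum 'I_d) (k + j) = Ordinal kjd.
    by apply: val_inj; rewrite /= nth_enum_ord.
  have /(all_nthP 0)/(_ j) := dropk; rewrite size_drop sg => /(_ jd).
  by rewrite nth_drop => /eqP -> /=; rewrite scale0r.
have [||||||G normG opG] := schur_horn a (take k gamma) (take k Gd).
- by rewrite size_takel // sg.
- exact: a_decr.
- exact: take_sorted.
- move=> j; case: (leqP j k) => jk; first by rewrite take_takel.
  rewrite [X in _ <= tr X]take_oversize ?trk.
    by rewrite take_oversize // ltnW.
  by rewrite size_take_min (leq_trans (geq_minl _ _)) // ltnW.
- by rewrite trk.
- by rewrite !map_take normGd.
by exists G; rewrite // opG opk.
Qed.

Lemma optimal_attained : exists2 G,
  [seq dotmx g g | g <- G] = [seq t%:C | t <- a] &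
  eig_desc (frame_op (F0 ++ G)) = desc (optimal_spectrum rho a).
Proof.
have [P Pu EA] := sorted_spectral _ (frame_op_hermitian F0).
have [G normG opG] := frame_with_spectrum _ _ optimal_increment_admissible Pu.
exists G => //; rewrite /eig_desc /desc; apply/perm_sortP.
- by move=> u v; apply: le_total.
- by move=> u v w uv wu; apply: le_trans wu uv.
- by move=> u v; rewrite andbC; apply: le_anti.
have so : size (optimal_spectrum rho a) = d.
  by rewrite size_optimal ?size_rho // ?rho_incr // size_rho.
apply: (perm_eigenvalues _ _ _ Pu so).
rewrite frame_op_cat EA opG -mulmxDl -mulmxDr -raddfD /=; congr (_ *m diag_mx _ *m _).
apply/rowP => j; rewrite !mxE -rmorphD /=; congr (_%:C).
rewrite -/rho -(@addv_optimal_increment _ rho a rho_incr a_decr a_pos size_a_rho) -/mu.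
have smu : size rho = size mu by rewrite size_rho; have [-> _ _ _] := optimal_increment_admissible.
by rewrite (nth_map (0, 0)) ?nth_zip // size_zip -smu minnn size_rho.
Qed.

Lemma optimal_least G : [seq dotmx g g | g <- G] = [seq t%:C | t <- a] ->
  majorized (desc (optimal_spectrum rho a)) (eig_desc (frame_op (F0 ++ G))).
Proof.
move=> normG; apply: hinge_majorized.
- by rewrite size_optimal ?rho_incr ?size_eigenvalues ?size_rho // size_rho.
- apply: (@complexI R); rewrite tr_eigenvalues ?frame_op_hermitian //.
  rewrite tr_optimal ?rho_incr ?size_a_rho // rmorphD /=.
  rewrite frame_op_cat mxtraceD; congr (_ + _).
    rewrite -(tr_eigenvalues _ (frame_op_hermitian F0)).
    by rewrite (tr_perm _ _ (perm_eig_asc _)).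
  rewrite /frame_op [RHS]raddf_sum /= /tr rmorph_sum /=.
  rewrite -(big_map (fun t => t%:C) predT id) -normG big_map.
  by apply: eq_bigr => g _; rewrite tr_rank_one.
- apply: optimal_hinge; rewrite ?rho_incr ?size_a_rho // => t p pk.
  by apply: eigenvalues_hinge => //; apply: leq_trans pk size_a.
Qed.

Lemma tuple_norms n (b : n.-tuple R) (G : n.-tuple 'rV[R[i]]_d) :
  (forall j, dotmx (tnth G j) (tnth G j) = (tnth b j)%:C) <->
  [seq dotmx g g | g <- G] = [seq t%:C | t <- b].
Proof.
split=> [E|E].
  apply: (@eq_from_nth _ 0); rewrite !size_map !size_tuple // => i id.
  rewrite (nth_map 0) ?size_tuple // (nth_map 0) ?size_tuple //.
  by have := E (Ordinal id); rewrite !(tnth_nth 0).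
move=> j; have := congr1 (fun l => l`_j) E.
by rewrite !(tnth_nth 0) (nth_map 0) ?size_tuple // (nth_map 0) ?size_tuple.
Qed.

End Completion.

Theorem theorem4p8 (R : realType) (d k : nat) (F0 : seq 'rV[R[i]]_d)
    (a : k.-tuple R) (f : R -> R)
    (a_pos : forall j, 0 < tnth a j)
    (a_decr : decreasing a)
    (data : (d - \rank (frame_op F0) <= k)%N)
    (dk : (0 < d - k)%N)
    (f_convex : strictly_convex f) :
  let lam := eig_asc (frame_op F0) in
  let lam' := take k lam in
  let nu := nu_opt f lam a in
  [/\ nu = nu_opt f lam' a ++ drop k lam,
      nu_opt f lam' a = Ncal lam' a,
      (forall g : R -> R, strictly_convex g -> nu_opt g lam a = nu),
      Lambda F0 a (desc nu) &
      forall gamma, Lambda F0 a gamma -> majorized (desc nu) gamma].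
Proof.
move=> lam lam' nu.
have ap : all (fun t => 0 < t) a by apply/all_tnthP.
have ka : size a = k by rewrite size_tuple.
have ad : (size a <= d)%N by rewrite ka ltnW // -subn_gt0.
have explicit g : strictly_convex g -> nu_opt g lam a = optimal_spectrum lam a.
  move=> gc; apply: nu_opt_explicit => //; first exact: eig_asc_increasing.
    exact: eig_asc_ge0.
  by rewrite size_eig_asc.
have slam' : size lam' = size a by rewrite ka size_takel // size_eig_asc -ka.
have nu' : nu_opt f lam' a = Ncal lam' a.
  rewrite nu_opt_explicit ?slam' //; first last.
  - by apply/allP => t /mem_take; apply: (allP (eig_asc_ge0 F0)).
  - exact/take_sorted/eig_asc_increasing.
  by rewrite /optimal_spectrum -slam' take_size drop_size cats0.
rewrite /nu; split=> //.
- by rewrite nu' explicit // /optimal_spectrum ka.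
- by move=> g gc; rewrite !explicit.
- rewrite explicit //; have [G normG eigG] := optimal_attained F0 a a_decr ap ad.
  have sG : size G == k.
    by rewrite -(size_map (fun g => dotmx g g)) normG size_map ka.
  exists (F0 ++ G) => //; exists (Tuple sG); split=> //.
  exact/tuple_norms.
- move=> gamma [F [G [normG ->]] <-]; rewrite explicit //.
  by apply: optimal_least => //; apply/tuple_norms.
Qed.
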